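(* There exists a map $f_\infty: D^2\to \mathbb{E}^3$ which is $\beta$-Hölder for any $0<\beta<1$ and whose restriction to the interior $\mathrm{Int}\,D^2$ is a $C^1$-isometric embedding of the hyperbolic plane $\mathbb{H}^2=(\mathrm{Int}\,D^2,h)$ into $\mathbb{E}^3$. The limit set of this embedding is a closed curve of Hausdorff dimension $1$.
   Context: $D^2$ is the closed unit disk of the Euclidean plane $\mathbb{E}^2$, $\mathbb{E}^3$ is Euclidean 3-space, and $h=4\frac{dx^2+dy^2}{(1-x^2-y^2)^2}$ is the hyperbolic metric on $\mathrm{Int}\,D^2$ (Poincaré disk model $\mathbb{H}^2=(\mathrm{Int}\,D^2,h)$). A $C^1$ map $f:\mathrm{Int}\,D^2\to\mathbb{E}^3$ is isometric if $f^*\langle\cdot,\cdot\rangle=h$, where $(f^*\langle\cdot,\cdot\rangle)(v,w)=\langle df(v),df(w)\rangle$. The limit set of a map $f:\mathbb{H}^2\to\mathbb{E}^3$ is the set of points of $\mathbb{E}^3$ that are limits of sequences $(f(p_n))_n$, where $(p_n)_n$ is a sequence of points of $\mathbb{H}^2$ converging to infinity in the Alexandroff one-point compactification of $\mathbb{H}^2$. *)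

(* Defs.v *)
From HB Require Import structures.
From mathcomp Require Import all_boot all_order all_algebra.
From mathcomp Require Import all_classical all_reals all_analysis.

Set Implicit Arguments.
Unset Strict Implicit.
Unset Printing Implicit Defensive.

Import Order.TTheory GRing.Theory Num.Theory.
Import numFieldNormedType.Exports.

Local Open Scope classical_set_scope.
Local Open Scope ring_scope.

(* The Euclidean space E^n is 'rV[R]_n. The norm that the library puts on
   'rV[R]_n is the sup norm: it is used here only through the topology and the
   differential it induces, which are the Euclidean ones. Every metric notion
   (disk, Hoelder condition, diameter) uses enorm below. *)
Section Euclidean.
Context {R : realType}.

Definition edot n (u v : 'rV[R]_n) : R := \sum_i u 0 i * v 0 i.

Definition enorm n (u : 'rV[R]_n) : R := Num.sqrt (edot u u).

Definition edist n (p q : 'rV[R]_n) : R := enorm (p - q).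

Definition holder_on n m (A : set 'rV[R]_n) (b : R)
    (f : 'rV[R]_n -> 'rV[R]_m) : Prop :=
  exists C : R, forall p q, A p -> A q ->
    edist (f p) (f q) <= C * edist p q `^ b.

(* For U open. *)
Definition C1_on n m (U : set 'rV[R]_n) (f : 'rV[R]_n -> 'rV[R]_m) : Prop :=
  forall p, U p -> differentiable f p /\ {for p, continuous (jacobian f)}.

Definition immersion_on n m (U : set 'rV[R]_n)
    (f : 'rV[R]_n -> 'rV[R]_m) : Prop :=
  forall p, U p -> injective ('d f p).

Definition ediam n (A : set 'rV[R]_n) : \bar R :=
  ereal_sup [set (edist p q)%:E | p in A & q in A].

(* diam(A)^s, with diam(A)^0 = 1 for A nonempty. The empty set is treated apart:
   its ediam is -oo, and its contribution must be 0 even for s = 0. *)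
Definition hausdorff_gauge n (s : R) (A : set 'rV[R]_n) : \bar R :=
  if A == set0 then 0%E else (ediam A `^ s)%E.

Definition hausdorff_content n (s d : R) (A : set 'rV[R]_n) : \bar R :=
  ereal_inf [set (\sum_(0 <= k <oo) hausdorff_gauge s (U k))%E | U in
    [set U : nat -> set 'rV[R]_n |
      A `<=` \bigcup_k U k /\ forall k, (ediam (U k) <= d%:E)%E]].

Definition hausdorff_measure n (s : R) (A : set 'rV[R]_n) : \bar R :=
  ereal_sup [set hausdorff_content s d A | d in [set d : R | 0 < d]].

Definition hausdorff_dim n (A : set 'rV[R]_n) : \bar R :=
  ereal_inf [set s%:E | s in
    [set s : R | 0 <= s /\ hausdorff_measure s A = 0%E]].

Definition closed_curve n (A : set 'rV[R]_n) : Prop :=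
  exists g : R -> 'rV[R]_n,
    [/\ {within `[0, 1], continuous g}, g 0 = g 1 & g @` `[0, 1] = A].

End Euclidean.

(* Homeomorphism onto the image. *)
Definition topological_embedding (X Y : topologicalType) (f : X -> Y) : Prop :=
  [/\ injective f, continuous f &
      forall U : set X, open U -> exists2 V : set Y, open V & U = f @^-1` V].

(* None is the point at infinity of one_point_compactification X. *)
Definition limit_set (X Y : topologicalType) (f : X -> Y) : set Y :=
  [set y | exists p : nat -> X,
     (Some (p k) : one_point_compactification X) @[k --> \oo]
       --> (None : one_point_compactification X) /\
     f (p k) @[k --> \oo] --> y].

Section Hyperbolic.
Variable R : realType.

Definition closed_disk : set 'rV[R]_2 := [set p | enorm p <= 1].

Definition open_disk : set 'rV[R]_2 := closed_disk°.

(* The underlying space of H^2; its topology as a Riemannian manifold is the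
   subset topology, which is the one carried by set_type. *)
Definition hyperbolic_plane : topologicalType := set_type open_disk.

(* The bilinear form 4 (dx^2 + dy^2) / (1 - x^2 - y^2)^2 at p = (x, y). *)
Definition hyperbolic_metric (p v w : 'rV[R]_2) : R :=
  4 * edot v w / (1 - edot p p) ^+ 2.

Definition restrict_interior (f : 'rV[R]_2 -> 'rV[R]_3) :
    hyperbolic_plane -> 'rV[R]_3 :=
  fun p => f (set_val p).

Definition hyperbolic_isometric (f : 'rV[R]_2 -> 'rV[R]_3) : Prop :=
  forall p, open_disk p -> forall v w,
    edot ('d f p v) ('d f p w) = hyperbolic_metric p v w.

Definition C1_isometric_embedding (f : 'rV[R]_2 -> 'rV[R]_3) : Prop :=
  [/\ C1_on open_disk f, immersion_on open_disk f,
      topological_embedding (restrict_interior f) & hyperbolic_isometric f].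

End Hyperbolic.

(* Main.v *)
(* Explicit Nash-Kuiper iteration. The metrics G_k (dx^2 + dy^2) with
   G_k = 4 / (1 - x^2 - y^2 + a_k)^2, a_k = a_0 q^k and q close to 1, are smooth on
   the closed disk and increase to h on its interior. A map f_k that is almost
   isometric for G_k is turned into f_(k+1) by three successive corrugations, one
   for each term of a decomposition of the metric defect into squares of linear
   forms. A corrugation of frequency N adds the intended term up to errors
   O(1/N) + O(defect^2 / G); the second one is negligible because
   G_(k+1) - G_k <= G_k / 10^4. Since a corrugation only involves the field
   operations, square roots, sin and cos, all the f_k are elementary functions, and
   every derivative of f_k is bounded on the closed disk.

   The frequencies are free, so |f_(k+1) - f_k| <= eps_k with eps_k as small as we
   wish, while |d f_(k+1) - d f_k| <= C sqrt(G_(k+1) - G_k), which is summable in k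
   locally uniformly in the interior and at most C q^(-k) on the disk. Hence the
   limit f is C^1 and isometric in the interior, and, for eps_k superexponentially
   small, Hoelder of every exponent b < 1 on the disk. As d f_(k+1) is also close to
   d f_k, each f_k expands distances by some m_k > 0, and eps_k << m_k / k makes f
   injective on the compact disk, hence an embedding.

   The limit set is the image of the unit circle: its dimension is at most 1 by the
   Hoelder bounds, and at least 1 because it is a nonconstant curve. *)
Require Import Defs.
From mathcomp Require Import all_boot all_order all_algebra.
From mathcomp Require Import all_classical all_reals all_analysis.
From mathcomp Require Import ring lra.
(* The library's [edist] would otherwise shadow the one of Defs. *)
Import Defs.
Import Order.TTheory GRing.Theory Num.Theory.
Import numFieldNormedType.Exports.
Local Open Scope classical_set_scope.
Local Open Scope ring_scope.

Set Implicit Arguments.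
Unset Strict Implicit.
Unset Printing Implicit Defensive.

(** * Euclidean norm *)

(** The corrugation is a trigonometric polynomial in the phase. Its tangential term cancels the
    oscillation of the normal one, but leaves its own squared length, of order a^2 / G. This is what
    forces every metric increment D_k = G_(k+1) - G_k to be a tiny fraction of G_k, hence q so close
    to 1.

    The linear forms are dx, dx + 2dy and dx - 2dy because dx^2 + dy^2 = 3/4 dx^2 + 1/8 (dx + 2dy)^2
    + 1/8 (dx - 2dy)^2 has positive coefficients; a defect close to a multiple of dx^2 + dy^2
    therefore still has positive coefficients. So f_k need not be short for G_k: its metric is only
    kept within D_k / 8 of G_k, on either side.

    The offset a_0 is chosen so large that G_0 is almost constant on the disk, and a flat homothetic
    disk can start the iteration.

    The maps f_k are syntax trees differentiated symbolically. All constants attached to f_k are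
    thus available before the next frequency is chosen. *)

Section EuclideanNorm.
Context {R : realType}.

Section AnyDim.
Context {n : nat}.
Implicit Types (u v w : 'rV[R]_n) (c : R).

Lemma edotC u v : edot u v = edot v u.
Proof. by apply: eq_bigr => i _; rewrite mulrC. Qed.

Lemma edotDl u v w : edot (u + v) w = edot u w + edot v w.
Proof. by rewrite -big_split; apply: eq_bigr => i _; rewrite mxE mulrDl. Qed.

Lemma edotZl c u v : edot (c *: u) v = c * edot u v.
Proof. by rewrite mulr_sumr; apply: eq_bigr => i _; rewrite mxE mulrA. Qed.

Lemma edotDr u v w : edot u (v + w) = edot u v + edot u w.
Proof. by rewrite edotC edotDl !(edotC u). Qed.

Lemma edotZr c u v : edot u (c *: v) = c * edot u v.
Proof. by rewrite edotC edotZl edotC. Qed.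

Lemma edotNl u v : edot (- u) v = - edot u v.
Proof. by rewrite -scaleN1r edotZl mulN1r. Qed.

Lemma edotNr u v : edot u (- v) = - edot u v.
Proof. by rewrite edotC edotNl edotC. Qed.

Lemma edot0l v : edot 0 v = 0.
Proof. by rewrite -(scale0r (0 : 'rV[R]_n)) edotZl mul0r. Qed.

Definition edotE := (edotDl, edotDr, edotNl, edotNr, edotZl, edotZr).

Lemma edot_ge0 u : 0 <= edot u u.
Proof. by apply: sumr_ge0 => i _; rewrite -expr2 sqr_ge0. Qed.

Lemma enorm_ge0 u : 0 <= enorm u. Proof. exact: sqrtr_ge0. Qed.

Lemma sqr_enorm u : enorm u ^+ 2 = edot u u.
Proof. by rewrite sqr_sqrtr ?edot_ge0. Qed.

Lemma edot_le_enorm u v : edot u v <= enorm u * enorm v.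
Proof.
(* Cauchy-Schwarz is [key] for a = |v| and b = |u|, divided by 2 |u| |v|; null vectors are treated
   apart. *)
have key (a b : R) : 2 * a * b * edot u v <= a ^+ 2 * edot u u + b ^+ 2 * edot v v.
  have := edot_ge0 (a *: u - b *: v).
  by rewrite !edotE (edotC v u); lra.
have [u0|u0] := eqVneq (enorm u) 0.
  have [|v1] := ltrP 0 (edot u v); last by rewrite u0 mul0r.
  have uu : edot u u = 0 by rewrite -sqr_enorm u0 expr0n.
  (* With |u| = 0 the right side of [key] is |v|^2 whatever a is; this a makes the left side |v|^2 +
     1. *)
  move=> uv; have := key ((edot v v + 1) / (2 * edot u v)) 1.
  rewrite uu mulr0 add0r expr1n mul1r mulr1 -mulrA.
  have -> : 2 * ((edot v v + 1) / (2 * edot u v) * edot u v) = edot v v + 1.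
    by field; rewrite gt_eqF.
  by lra.
have [v0|v0] := eqVneq (enorm v) 0.
  have [|v1] := ltrP 0 (edot u v); last by rewrite v0 mulr0.
  have vv : edot v v = 0 by rewrite -sqr_enorm v0 expr0n.
  move=> uv; have := key 1 ((edot u u + 1) / (2 * edot u v)).
  rewrite vv mulr0 addr0 expr1n mul1r mulr1 -mulrA.
  have -> : 2 * ((edot u u + 1) / (2 * edot u v) * edot u v) = edot u u + 1.
    by field; rewrite gt_eqF.
  by lra.
have up : 0 < enorm u by rewrite lt_def u0 enorm_ge0.
have vp : 0 < enorm v by rewrite lt_def v0 enorm_ge0.
have := key (enorm v) (enorm u); rewrite -!sqr_enorm => h.
have P : 0 < 2 * enorm v * enorm u by rewrite !mulr_gt0.
rewrite -(ler_pM2l P) (le_trans h)//.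
by rewrite [leRHS](_ : _ = enorm v ^+ 2 * enorm u ^+ 2 + enorm u ^+ 2 * enorm v ^+ 2) //; ring.
Qed.

Lemma normr_edot u v : `|edot u v| <= enorm u * enorm v.
Proof.
rewrite ler_norml edot_le_enorm andbT lerNl -edotNl.
by apply: (le_trans (edot_le_enorm _ _)); rewrite /enorm edotNl edotNr opprK.
Qed.

Lemma enormZ c u : enorm (c *: u) = `|c| * enorm u.
Proof. by rewrite /enorm edotZl edotZr mulrA -expr2 sqrtrM ?sqr_ge0// sqrtr_sqr. Qed.

Lemma enormN u : enorm (- u) = enorm u.
Proof. by rewrite -scaleN1r enormZ normrN1 mul1r. Qed.

Lemma enorm0 : enorm (0 : 'rV[R]_n) = 0.
Proof. by rewrite /enorm edot0l sqrtr0. Qed.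

Lemma enormD u v : enorm (u + v) <= enorm u + enorm v.
Proof.
rewrite -(@ler_pXn2r _ 2) ?nnegrE ?addr_ge0 ?enorm_ge0// sqr_enorm !edotE.
rewrite -!sqr_enorm sqrrD (edotC v u).
by have := edot_le_enorm u v; lra.
Qed.

Lemma enormB u v : enorm (u - v) <= enorm u + enorm v.
Proof. by rewrite -(enormN v) enormD. Qed.

Lemma enormBC u v : enorm (u - v) = enorm (v - u).
Proof. by rewrite -enormN opprB. Qed.

Lemma enorm_coord u i : `|u 0 i| <= enorm u.
Proof.
rewrite -sqrtr_sqr ler_sqrt ?edot_ge0// /edot (bigD1 i)//= -expr2 lerDl.
by apply: sumr_ge0 => j _; rewrite -expr2 sqr_ge0.
Qed.

Lemma enorm_le_sum u : enorm u <= \sum_i `|u 0 i|.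
Proof.
rewrite -(@ler_pXn2r _ 2) ?nnegrE ?enorm_ge0 ?sumr_ge0//.
rewrite sqr_enorm /edot [leRHS]expr2 mulr_suml; apply: ler_sum => i _.
rewrite (le_trans (ler_norm _))// normrM ler_wpM2l// (bigD1 i)//= lerDl.
exact: sumr_ge0.
Qed.

Lemma enorm_eq0 u : enorm u = 0 -> u = 0.
Proof.
move=> u0; apply/rowP => i; rewrite mxE; apply/eqP.
by rewrite -normr_le0 -u0 enorm_coord.
Qed.

Lemma mx_norm_le_enorm u : `|u| <= enorm u.
Proof.
rewrite [`|u|]mx_normrE bigmax_le ?enorm_ge0// => -[i j] _ /=.
by rewrite (ord1 i) enorm_coord.
Qed.

Lemma coord_le_mx_norm u i : `|u 0 i| <= `|u|.
Proof.
rewrite [`|u|]mx_normrE.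
exact: (le_trans _ (@le_bigmax _ R _ _ (fun ij : 'I_1 * 'I_n => `|u ij.1 ij.2|) (0, i))).
Qed.

Lemma enorm_le_mx_norm u : enorm u <= n%:R * `|u|.
Proof.
rewrite (le_trans (enorm_le_sum u))//.
rewrite (@le_trans _ _ (\sum_(i < n) `|u|))//.
  by apply: ler_sum => i _; exact: coord_le_mx_norm.
by rewrite sumr_const card_ord mulr_natl.
Qed.

End AnyDim.

Lemma edot2 (u v : 'rV[R]_2) : edot u v = u 0 0 * v 0 0 + u 0 1 * v 0 1.
Proof.
rewrite /edot !big_ord_recl big_ord0 addr0.
by congr (_ + u 0 _ * v 0 _); apply/val_inj.
Qed.

Lemma edot3 (u v : 'rV[R]_3) :
  edot u v = u 0 0 * v 0 0 + u 0 1 * v 0 1 + u 0 2 * v 0 2.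
Proof.
rewrite /edot !big_ord_recl big_ord0 addr0 addrA.
by congr (_ + u 0 _ * v 0 _ + u 0 _ * v 0 _); apply/val_inj.
Qed.

End EuclideanNorm.

(** * Elementary functions on the closed disk *)

Section Expressions.
Context {R : realType}.
Local Notation disk := (@closed_disk R).

(** Differentiation becomes the recursive function [pd], and bounds on derivatives follow by
    induction. The inverse square root is the only root: its derivative - u' u^(-3/2) / 2 is a
    polynomial in it and u', and its square gives quotients by positive functions. *)
Inductive expr : Type :=
| Coord of bool
| Cst of R
| Add of expr & expr
| Mul of expr & expr
| Isqrt of expr
| Sin of expr
| Cos of expr.

Definition axis (b : bool) : 'I_2 := if b then 1 else 0.

Fixpoint ev (e : expr) (p : 'rV[R]_2) : R :=
  match e with
  | Coord b => p 0 (axis b)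
  | Cst c => c
  | Add e1 e2 => ev e1 p + ev e2 p
  | Mul e1 e2 => ev e1 p * ev e2 p
  | Isqrt e1 => (Num.sqrt (ev e1 p))^-1
  | Sin e1 => sin (ev e1 p)
  | Cos e1 => cos (ev e1 p)
  end.

Fixpoint pd (b : bool) (e : expr) : expr :=
  match e with
  | Coord b' => Cst (b == b')%:R
  | Cst c => Cst 0
  | Add e1 e2 => Add (pd b e1) (pd b e2)
  | Mul e1 e2 => Add (Mul (pd b e1) e2) (Mul e1 (pd b e2))
  | Isqrt e1 =>
    Mul (Mul (Cst (- 2^-1)) (pd b e1)) (Mul (Isqrt e1) (Mul (Isqrt e1) (Isqrt e1)))
  | Sin e1 => Mul (pd b e1) (Cos e1)
  | Cos e1 => Mul (Mul (Cst (-1)) (pd b e1)) (Sin e1)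
  end.

(** The uniform lower bound makes [Isqrt] bounded without any appeal to compactness. *)
Definition positive_on_disk (e : expr) : Prop :=
  exists2 c, 0 < c & forall p, disk p -> c <= ev e p.

(* Defined on the whole closed disk, with no square root of a function that
   approaches 0 there. *)
Fixpoint wd (e : expr) : Prop :=
  match e with
  | Coord _ | Cst _ => True
  | Add e1 e2 | Mul e1 e2 => wd e1 /\ wd e2
  | Isqrt e1 => wd e1 /\ positive_on_disk e1
  | Sin e1 | Cos e1 => wd e1
  end.

Lemma wd_pd b e : wd e -> wd (pd b e).
Proof. by elim: e => //= [e1 h1 e2 h2|e1 h1 e2 h2|e1 h1|e1 h1|e1 h1]; tauto. Qed.

Definition dir_deriv (e : expr) (p v : 'rV[R]_2) : R :=
  ev (pd false e) p * v 0 0 + ev (pd true e) p * v 0 1.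

Lemma ev_is_derive e (p v : 'rV[R]_2) (t : R) : wd e -> disk (p + t *: v) ->
  is_derive t 1 (fun s => ev e (p + s *: v)) (dir_deriv e (p + t *: v) v).
Proof.
move=> + dt; rewrite /dir_deriv.
elim: e => [b|c|e1 h1 e2 h2|e1 h1 e2 h2|e1 h1|e1 h1|e1 h1] /=.
- move=> _.
  have -> : (fun s => (p + s *: v) 0 (axis b)) = (fun s => p 0 (axis b) + s * v 0 (axis b)).
    by apply/funext => s; rewrite !mxE.
  have -> : (false == b)%:R * v 0 0 + (true == b)%:R * v 0 1 = 0 + (t *: 0 + v 0 (axis b) *: 1) :> R.
    by case: b; rewrite /= ?mul0r ?mul1r ?scaler0 !add0r ?addr0 /GRing.scale /= mulr1.
  by apply: is_deriveD; apply: is_deriveM.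
- by move=> _; rewrite !mul0r addr0; apply: is_derive_cst.
- by move=> [/h1 {}h1 /h2 {}h2]; apply: is_derive_eq; ring.
- move=> [/h1 {}h1 /h2 {}h2]; apply: is_derive_eq.
  by rewrite /GRing.scale /=; ring.
- move=> [/h1 {}h1 [c c0 /(_ _ dt) cle]].
  have e0 : 0 < ev e1 (p + t *: v) by exact: lt_le_trans cle.
  have s0 : Num.sqrt (ev e1 (p + t *: v)) != 0 by rewrite gt_eqF// sqrtr_gt0.
  have hs : is_derive (ev e1 (p + t *: v)) 1 (fun x => (Num.sqrt x)^-1)
     (- (Num.sqrt (ev e1 (p + t *: v))) ^- 2 *: (2 * Num.sqrt (ev e1 (p + t *: v)))^-1).
    have := is_derive1_sqrt e0 => h.
    split; first by apply: derivableV => //.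
    by rewrite deriveV// derive_val.
  apply: (@is_derive_eq _ _ _ _ _ _ _ _ (is_derive1_comp (g := fun s => ev e1 (p + s *: v)) hs h1)).
  by rewrite /GRing.scale /=; field.
- move=> /h1 {}h1.
  apply: (@is_derive_eq _ _ _ _ _ _ _ _ (is_derive1_comp (g := fun s => ev e1 (p + s *: v)) (is_derive_sin _) h1)).
  by rewrite /GRing.scale /=; ring.
- move=> /h1 {}h1.
  apply: (@is_derive_eq _ _ _ _ _ _ _ _ (is_derive1_comp (g := fun s => ev e1 (p + s *: v)) (is_derive_cos _) h1)).
  by rewrite /GRing.scale /=; ring.
Qed.

Lemma ev_bounded e : wd e -> exists2 M, 0 < M & forall p, disk p -> `|ev e p| <= M.
Proof.
elim: e => [b|c|e1 h1 e2 h2|e1 h1 e2 h2|e1 h1|e1 h1|e1 h1] /=.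
- by move=> _; exists 1 => // p; apply: le_trans; exact: enorm_coord.
- by move=> _; exists (`|c| + 1) => [|p _]; rewrite ?ltr_wpDl// lerDl.
- move=> [/h1[M M0 hM] /h2[N N0 hN]]; exists (M + N) => [|p dp]; first exact: addr_gt0.
  by rewrite (le_trans (ler_normD _ _))// lerD ?hM ?hN.
- move=> [/h1[M M0 hM] /h2[N N0 hN]]; exists (M * N) => [|p dp]; first exact: mulr_gt0.
  by rewrite normrM ler_pM ?hM ?hN.
- move=> [_ [c c0 hc]]; exists (Num.sqrt c)^-1; first by rewrite invr_gt0 sqrtr_gt0.
  move=> p dp; have e0 : 0 < ev e1 p by apply: lt_le_trans (hc _ dp).
  by rewrite ger0_norm ?invr_ge0 ?sqrtr_ge0// lef_pV2 ?posrE ?sqrtr_gt0// ler_sqrt ?hc// ltW.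
- move=> _; exists 1 => // p _.
  by rewrite ler_norml sin_geN1 sin_le1.
- move=> _; exists 1 => // p _.
  by rewrite ler_norml cos_geN1 cos_le1.
Qed.

Lemma ball_segment (r : R) (p q : 'rV[R]_2) (t : R) : enorm p <= r -> enorm q <= r ->
  0 <= t <= 1 -> enorm (p + t *: (q - p)) <= r.
Proof.
move=> dp dq /andP[t0 t1].
have -> : p + t *: (q - p) = (1 - t) *: p + t *: q.
  by rewrite scalerBr scalerBl scale1r addrA addrAC.
rewrite (le_trans (enormD _ _))// !enormZ (ger0_norm t0) ger0_norm ?subr_ge0//.
have : (1 - t) * enorm p <= (1 - t) * r by rewrite ler_wpM2l// subr_ge0.
have : t * enorm q <= t * r by rewrite ler_wpM2l.
by lra.
Qed.

(** The point z lies on the segment from p to q, hence in every centred ball containing both. The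
    clause on r is there because the estimates in the interior are uniform only on balls of radius r
    < 1. *)
Lemma ev_mvt e (p q : 'rV[R]_2) : wd e -> disk p -> disk q ->
  exists z, [/\ disk z, forall r, enorm p <= r -> enorm q <= r -> enorm z <= r,
    enorm (z - p) <= enorm (q - p) & ev e q - ev e p = dir_deriv e z (q - p)].
Proof.
move=> we dp dq.
have hd (t : R) : t \in `[0, 1]%R -> is_derive t 1 (fun s => ev e (p + s *: (q - p)))
   (dir_deriv e (p + t *: (q - p)) (q - p)).
  by move=> t01; apply: ev_is_derive => //; apply: ball_segment.
have [|c c01] := MVT_segment (@ler01 R) (fun t ht => hd t (subset_itv_oo_cc ht)).
  apply: derivable_within_continuous => t t01.
  by have [] := hd _ t01.
rewrite subr0 mulr1 scale1r scale0r addr0 [p + _]addrC subrK => h.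
exists (p + c *: (q - p)); split => //; first exact: ball_segment.
  by move=> r pr qr; exact: ball_segment.
rewrite [p + _]addrC addrK enormZ ler_piMl ?enorm_ge0//.
by move: c01; rewrite in_itv/= => /andP[c0 c1]; rewrite ger0_norm.
Qed.

Lemma ev_lipschitz e : wd e ->
  exists2 M, 0 < M & forall p q, disk p -> disk q -> `|ev e q - ev e p| <= M * enorm (q - p).
Proof.
move=> we; have [M M0 hM] := ev_bounded (wd_pd false we).
have [N N0 hN] := ev_bounded (wd_pd true we).
exists (M + N) => [|p q dp dq]; first exact: addr_gt0.
have [z [dz _ _ ->]] := ev_mvt we dp dq.
rewrite (le_trans (ler_normD _ _))// mulrDl !normrM.
by rewrite lerD// ler_pM ?hM ?hN ?enorm_coord.
Qed.

End Expressions.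
Arguments expr R : clear implicits.

(** * Corrugations *)

Section VectorExpressions.
Context {R : realType}.
Local Notation disk := (@closed_disk R).

Definition crossv (u v : 'rV[R]_3) : 'rV[R]_3 :=
  \row_(i < 3) if i == 0 then u 0 1 * v 0 2 - u 0 2 * v 0 1
       else if i == 1 then u 0 2 * v 0 0 - u 0 0 * v 0 2
       else u 0 0 * v 0 1 - u 0 1 * v 0 0.

Lemma edot_crossvl u v : edot (crossv u v) u = 0.
Proof. by rewrite edot3 !mxE /=; ring. Qed.

Lemma edot_crossvr u v : edot (crossv u v) v = 0.
Proof. by rewrite edot3 !mxE /=; ring. Qed.

Lemma edot_crossv u v :
  edot (crossv u v) (crossv u v) = edot u u * edot v v - edot u v ^+ 2.
Proof. by rewrite !edot3 !mxE /=; ring. Qed.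

Definition vexpr := 'I_3 -> expr R.

Implicit Types (f g : vexpr) (e : expr R) (p q : 'rV[R]_2).

Definition vev f p : 'rV[R]_3 := \row_i ev (f i) p.
Definition vwd f : Prop := forall i, wd (f i).
Definition vpd b f : vexpr := fun i => pd b (f i).
Definition vscale e f : vexpr := fun i => Mul e (f i).
Definition vadd f g : vexpr := fun i => Add (f i) (g i).
Definition vdot f g : expr R :=
  Add (Add (Mul (f 0) (g 0)) (Mul (f 1) (g 1))) (Mul (f 2) (g 2)).
Definition Subtract e e' : expr R := Add e (Mul (Cst (-1)) e').
Definition vcross f g : vexpr := fun i =>
  if i == 0 then Subtract (Mul (f 1) (g 2)) (Mul (f 2) (g 1))
  else if i == 1 then Subtract (Mul (f 2) (g 0)) (Mul (f 0) (g 2))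
  else Subtract (Mul (f 0) (g 1)) (Mul (f 1) (g 0)).

Lemma ev_vdot f g p : ev (vdot f g) p = edot (vev f p) (vev g p).
Proof. by rewrite edot3 !mxE. Qed.

Lemma vev_scale e f p : vev (vscale e f) p = ev e p *: vev f p.
Proof. by apply/rowP => i; rewrite !mxE. Qed.

Lemma vev_add f g p : vev (vadd f g) p = vev f p + vev g p.
Proof. by apply/rowP => i; rewrite !mxE. Qed.

Lemma vev_cross f g p : vev (vcross f g) p = crossv (vev f p) (vev g p).
Proof.
apply/rowP => i; rewrite !mxE /vcross; case: eqP => _ /=; first by rewrite mulN1r.
by case: eqP => _ /=; rewrite mulN1r.
Qed.

Lemma vwd_pd b f : vwd f -> vwd (vpd b f).
Proof. by move=> wf i; exact: wd_pd. Qed.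

Lemma vwd_scale e f : wd e -> vwd f -> vwd (vscale e f).
Proof. by move=> we wf i; split. Qed.

Lemma vwd_add f g : vwd f -> vwd g -> vwd (vadd f g).
Proof. by move=> wf wg i; split. Qed.

Lemma wd_dot f g : vwd f -> vwd g -> wd (vdot f g).
Proof. by move=> wf wg; do !split. Qed.

Lemma vwd_cross f g : vwd f -> vwd g -> vwd (vcross f g).
Proof.
move=> wf wg i; rewrite /vcross; case: ifP => _; first by do !split.
by case: ifP => _; do !split.
Qed.

Lemma vev_bounded f : vwd f ->
  exists2 M, 0 < M & forall p, disk p -> enorm (vev f p) <= M.
Proof.
move=> wf; pose M i := sval (cid2 (ev_bounded (wf i))).
have M0 i : 0 < M i by rewrite /M; case: cid2.
have hM i p : disk p -> `|ev (f i) p| <= M i.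
  by rewrite /M; case: cid2 => /= x _ h; exact: h.
exists (\sum_i M i); first by rewrite (bigD1 0)//= ltr_pwDl// sumr_ge0// => i _; exact: ltW.
move=> p dp; rewrite (le_trans (enorm_le_sum _))//.
by apply: ler_sum => i _; rewrite mxE hM.
Qed.

Definition tangent f b p : 'rV[R]_3 := vev (vpd b f) p.
Definition metric f b c p : R := edot (tangent f b p) (tangent f c p).

End VectorExpressions.

Section Corrugation.
Context {R : realType}.
Local Notation disk := (@closed_disk R).
Implicit Types (f : vexpr (R := R)) (a : expr R) (p : 'rV[R]_2) (l : bool -> R).

Definition det_expr f : expr R :=
  Subtract (Mul (vdot (vpd false f) (vpd false f)) (vdot (vpd true f) (vpd true f)))
      (Mul (vdot (vpd false f) (vpd true f)) (vdot (vpd false f) (vpd true f))).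

(** The unit normal times sqrt(2a): the cross product has squared length [det_expr f], and 2a /
    sqrt(2a) encodes sqrt(2a) by an inverse root. *)
Definition normal_expr f a : vexpr :=
  vscale (Mul (Mul (Mul (Cst 2) a) (Isqrt (Mul (Cst 2) a))) (Isqrt (det_expr f)))
         (vcross (vpd false f) (vpd true f)).

(** The gradient of l for the metric induced by f: the inverse Gram matrix applied to l. *)
Definition grad_expr f l : vexpr :=
  vscale (Mul (Isqrt (det_expr f)) (Isqrt (det_expr f)))
    (vadd
      (vscale (Subtract (Mul (Cst (l false)) (vdot (vpd true f) (vpd true f)))
                   (Mul (Cst (l true)) (vdot (vpd false f) (vpd true f))))
              (vpd false f))
      (vscale (Subtract (Mul (Cst (l true)) (vdot (vpd false f) (vpd false f)))
                   (Mul (Cst (l false)) (vdot (vpd false f) (vpd true f))))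
              (vpd true f))).

Definition tangential_expr f a l : vexpr := vscale (Mul (Cst (- 2^-1)) a) (grad_expr f l).

Definition phase_expr l (h : R) : expr R :=
  Mul (Cst h^-1) (Add (Mul (Cst (l false)) (Coord false)) (Mul (Cst (l true)) (Coord true))).

(* The corrugation [f + h (sin s U + sin s cos s W)] of wavelength h in the
   direction l, with phase s = l(p)/h, U = sqrt(2a) * normal and W = -(a/2) * gradient
   of l: the oscillating term [2 a cos(s)^2 - a] of the normal displacement is
   cancelled by the tangential one. *)
Definition corrugate f a l h : vexpr :=
  vadd f (vscale (Mul (Cst h) (Sin (phase_expr l h)))
    (vadd (normal_expr f a) (vscale (Cos (phase_expr l h)) (tangential_expr f a l)))).

(** The phase has slope l b / h, which cancels the amplitude h; cos^2 - sin^2 is the derivative of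
    sin cos. Only the slow variation of U and W keeps a factor h. *)
Lemma tangent_corrugate f a l h b p : h != 0 ->
  let c := cos (ev (phase_expr l h) p) in let s := sin (ev (phase_expr l h) p) in
  let U := normal_expr f a in let W := tangential_expr f a l in
  tangent (corrugate f a l h) b p =
    tangent f b p + l b *: (c *: vev U p + (c ^+ 2 - s ^+ 2) *: vev W p)
    + h *: (s *: (tangent U b p + c *: tangent W b p)).
Proof.
move=> h0 c s U W; rewrite /tangent.
apply/rowP => i; rewrite !mxE /corrugate /vpd /vadd /vscale -/U -/W.
have d : ev (pd b (phase_expr l h)) p = l b / h by case: b => /=; ring.
rewrite [in pd _ _]/pd -/(pd b) -/pd; cbn [ev]; rewrite d -/c -/s.
by field.
Qed.

(** * Leading part of the corrugated metric at a point *)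

Section Pointwise.
Variables (f : vexpr (R := R)) (a : expr R) (l : bool -> R) (p : 'rV[R]_2).
Variable G : R.
Hypothesis G0 : 0 < G.
Hypothesis pinched : forall b c, `|metric f b c p - (b == c)%:R * G| <= G / 4.
Hypothesis a0 : 0 < ev a p.
Hypothesis l2 : l false ^+ 2 + l true ^+ 2 <= 5.

Let E := metric f false false p.
Let F := metric f false true p.
Let H := metric f true true p.

Lemma pinched_bounds : [/\ 3 / 4 * G <= E <= 5 / 4 * G, - (G / 4) <= F <= G / 4 &
   3 / 4 * G <= H <= 5 / 4 * G].
Proof.
have := pinched false false; have := pinched true true; have := pinched false true.
by rewrite /= !ler_norml /E /F /H; split; lra.
Qed.

Lemma ev_det_expr : ev (det_expr f) p = E * H - F ^+ 2.
Proof.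
rewrite /det_expr /Subtract; cbn [ev]; rewrite !ev_vdot /E /H /F /metric /tangent; ring.
Qed.

(** (3/4)^2 - (1/4)^2 = 1/2. *)
Lemma det_expr_ge : G ^+ 2 / 2 <= ev (det_expr f) p.
Proof.
have [/andP[h1 h2] /andP[h3 h4] /andP[h5 h6]] := pinched_bounds.
rewrite ev_det_expr.
have : (3 / 4 * G) * (3 / 4 * G) <= E * H by apply: ler_pM => //; lra.
have : F ^+ 2 <= (G / 4) ^+ 2.
  by rewrite -real_normK ?num_real// lerXn2r ?nnegrE ?ler_norml//; lra.
by rewrite !expr2; lra.
Qed.

Let det_gt0 : 0 < E * H - F ^+ 2.
Proof. by rewrite -ev_det_expr (lt_le_trans _ det_expr_ge)// divr_gt0// exprn_gt0. Qed.

Lemma vev_normal_expr : vev (normal_expr f a) p =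
  (2 * ev a p / Num.sqrt (2 * ev a p) / Num.sqrt (E * H - F ^+ 2)) *:
  crossv (tangent f false p) (tangent f true p).
Proof. by rewrite /normal_expr vev_scale vev_cross; cbn [ev]; rewrite ev_det_expr. Qed.

Lemma edot_normal_expr_tangent b : edot (vev (normal_expr f a) p) (tangent f b p) = 0.
Proof.
rewrite vev_normal_expr edotZl; case: b; rewrite ?edot_crossvr ?edot_crossvl mulr0//.
Qed.

Lemma edot_normal_expr : edot (vev (normal_expr f a) p) (vev (normal_expr f a) p) = 2 * ev a p.
Proof.
rewrite vev_normal_expr edotZl edotZr edot_crossv -/E -/F -/H.
rewrite -/(metric f false false p) -/(metric f true true p) -/(metric f false true p) -/E -/F -/H.
have h1 : Num.sqrt (2 * ev a p) ^+ 2 = 2 * ev a p by rewrite sqr_sqrtr// mulr_ge0// ltW.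
have h2 : Num.sqrt (E * H - F ^+ 2) ^+ 2 = E * H - F ^+ 2 by rewrite sqr_sqrtr// ltW.
have n1 : Num.sqrt (2 * ev a p) != 0 by rewrite gt_eqF// sqrtr_gt0 mulr_gt0.
have n2 : Num.sqrt (E * H - F ^+ 2) != 0 by rewrite gt_eqF// sqrtr_gt0.
rewrite -[in X in _ * (_ * X) = _]h2.
transitivity ((2 * ev a p) ^+ 2 / Num.sqrt (2 * ev a p) ^+ 2); first by field; rewrite n1 n2.
by rewrite h1; field; rewrite gt_eqF.
Qed.

Lemma vev_grad_expr : vev (grad_expr f l) p =
  (E * H - F ^+ 2)^-1 *: ((l false * H - l true * F) *: tangent f false p
     + (l true * E - l false * F) *: tangent f true p).
Proof.
rewrite /grad_expr vev_scale vev_add !vev_scale /Subtract; cbn [ev]; rewrite !ev_vdot ev_det_expr.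
rewrite -!/(tangent _ _ _) -!/(metric _ _ _ _) -/E -/F -/H !mulN1r.
congr (_ *: _); rewrite -invfM -expr2 sqr_sqrtr// ltW//.
Qed.

Lemma edot_grad_expr_tangent b : edot (vev (grad_expr f l) p) (tangent f b p) = l b.
Proof.
rewrite vev_grad_expr !edotE; case: b.
  rewrite -/(metric f false true p) -/(metric f true true p) -/F -/H.
  by field; rewrite gt_eqF.
rewrite (edotC (tangent f true p)) -/(metric f false true p) -/(metric f false false p).
by rewrite -/E -/F; field; rewrite gt_eqF.
Qed.

(** The squared length is g^-1(l, l). Its numerator is (E + H) |l|^2 minus the nonnegative value of
    the form g at l, so at most 5/2 G * 5, and its denominator is at least G^2 / 2. *)
Lemma edot_grad_expr : edot (vev (grad_expr f l) p) (vev (grad_expr f l) p) <= 25 / G.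
Proof.
rewrite [X in edot _ X]vev_grad_expr edotZr edotDr !edotZr !edot_grad_expr_tangent.
have [/andP[h1 h2] /andP[h3 h4] /andP[h5 h6]] := pinched_bounds.
have h7 : E + H <= 5 / 2 * G by lra.
have h8 := det_expr_ge; rewrite ev_det_expr in h8.
have h9 : (l false * H - l true * F) * l false + (l true * E - l false * F) * l true
   <= 25 / 2 * G.
  have : (l false * H - l true * F) * l false + (l true * E - l false * F) * l true
     <= (l false ^+ 2 + l true ^+ 2) * (E + H).
    rewrite -subr_ge0.
    have -> : (l false ^+ 2 + l true ^+ 2) * (E + H) -
      ((l false * H - l true * F) * l false + (l true * E - l false * F) * l true) =
      (l false ^+ 2 * E + 2 * (l true * l false) * F + l true ^+ 2 * H) by ring.
    (* These products are the certificate from which [lra] gets the positivity of the form with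
       matrix E, F, H. *)
    have q0 : 0 <= G / 4 * ((l false + l true) ^+ 2) by rewrite mulr_ge0 ?sqr_ge0//; lra.
    have q1 : 0 <= G / 4 * ((l false - l true) ^+ 2) by rewrite mulr_ge0 ?sqr_ge0//; lra.
    have q2 : 0 <= (E - 3/4 * G) * (l false ^+ 2) by rewrite mulr_ge0 ?sqr_ge0//; lra.
    have q3 : 0 <= (H - 3/4 * G) * (l true ^+ 2) by rewrite mulr_ge0 ?sqr_ge0//; lra.
    have q4 : 0 <= (F + G / 4) * ((l false + l true) ^+ 2) by rewrite mulr_ge0 ?sqr_ge0//; lra.
    have q5 : 0 <= (G / 4 - F) * ((l false - l true) ^+ 2) by rewrite mulr_ge0 ?sqr_ge0//; lra.
    have q6 : 0 <= G * l false ^+ 2 by rewrite mulr_ge0 ?sqr_ge0//; lra.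
    have q7 : 0 <= G * l true ^+ 2 by rewrite mulr_ge0 ?sqr_ge0//; lra.
    by lra.
  move=> /le_trans; apply.
  have : (l false ^+ 2 + l true ^+ 2) * (E + H) <= 5 * (5 / 2 * G).
    by apply: ler_pM => //; [rewrite addr_ge0 ?sqr_ge0|lra].
  by lra.
rewrite mulrC ler_pdivrMr// (le_trans h9)//.
have : 25 / G * (G ^+ 2 / 2) <= 25 / G * (E * H - F ^+ 2).
  by rewrite ler_wpM2l// divr_ge0// ltW.
apply: le_trans; rewrite [leRHS](_ : _ = 25 / 2 * G)//; field.
by rewrite gt_eqF.
Qed.

Lemma edot_normal_expr_grad_expr : edot (vev (normal_expr f a) p) (vev (grad_expr f l) p) = 0.
Proof. by rewrite vev_grad_expr !edotE !edot_normal_expr_tangent !mulr0 addr0 mulr0. Qed.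

Lemma vev_tangential_expr : vev (tangential_expr f a l) p = (- 2^-1 * ev a p) *: vev (grad_expr f l) p.
Proof. by rewrite /tangential_expr vev_scale. Qed.

(** Here x and y stand for cos s and sin s. The normal part contributes 2 a x^2 and the tangential
    cross terms - a (x^2 - y^2), which add up to a. What is left is the squared length of the
    tangential part, at most a^2 / 4 * 25 / G. *)
Lemma metric_corrugate_main b c (x y : R) Z : x ^+ 2 + y ^+ 2 = 1 ->
  Z = x *: vev (normal_expr f a) p + (x ^+ 2 - y ^+ 2) *: vev (tangential_expr f a l) p ->
  `|edot (tangent f b p + l b *: Z) (tangent f c p + l c *: Z)
    - metric f b c p - ev a p * l b * l c| <= `|l b * l c| * (25 / 4 * ev a p ^+ 2 / G).
Proof.
move=> xy ZE.
set T := vev (grad_expr f l) p.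
have Zt d : edot Z (tangent f d p) = - 2^-1 * ev a p * (x ^+ 2 - y ^+ 2) * l d.
  rewrite ZE vev_tangential_expr !edotE edot_normal_expr_tangent edot_grad_expr_tangent; ring.
have ZZ : edot Z Z = x ^+ 2 * (2 * ev a p) +
     (x ^+ 2 - y ^+ 2) ^+ 2 * (4^-1 * ev a p ^+ 2) * edot T T.
  rewrite ZE vev_tangential_expr !edotE edot_normal_expr (edotC (vev (grad_expr _ _) _) (vev (normal_expr _ _) _)).
  by rewrite edot_normal_expr_grad_expr -/T; field.
rewrite !edotE (edotC _ Z) !Zt ZZ -/(metric f b c p).
rewrite [X in `|X| <= _](_ : _ = l b * l c * ev a p * (x ^+ 2 + y ^+ 2 - 1) +
   l b * l c * ((x ^+ 2 - y ^+ 2) ^+ 2 * (4^-1 * ev a p ^+ 2 * edot T T))); last by field.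
rewrite xy subrr mulr0 add0r normrM ler_wpM2l//.
have TG := edot_grad_expr; rewrite -/T in TG.
have T0 := edot_ge0 T.
have a4 : 0 <= 4^-1 * ev a p ^+ 2 by rewrite mulr_ge0 ?sqr_ge0 ?invr_ge0.
have a4T : 0 <= 4^-1 * ev a p ^+ 2 * edot T T by exact: mulr_ge0.
rewrite ger0_norm; last by apply: mulr_ge0 => //; exact: sqr_ge0.
have k1 : (x ^+ 2 - y ^+ 2) ^+ 2 <= 1.
  have := sqr_ge0 x; have := sqr_ge0 y => h1 h2.
  rewrite -[leRHS](expr1n _ 2) -[leLHS]real_normK ?num_real// lerXn2r ?nnegrE// ler_norml.
  by apply/andP; split; lra.
apply: (@le_trans _ _ (1 * (4^-1 * ev a p ^+ 2 * (25 / G)))).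
  apply: ler_pM => //; first exact: sqr_ge0.
  by rewrite ler_wpM2l.
by rewrite [leLHS](_ : _ = 25 / 4 * ev a p ^+ 2 / G)//; field; rewrite gt_eqF.
Qed.

(** The normal part is bounded by sqrt 2 <= 3/2. The tangential part has length at most (a / 2) * 5
    / sqrt G, which a <= G / 50 brings below sqrt(a) / 2. *)
Lemma enorm_corrugate_main (x y : R) : x ^+ 2 + y ^+ 2 = 1 -> ev a p <= G / 50 ->
  enorm (x *: vev (normal_expr f a) p + (x ^+ 2 - y ^+ 2) *: vev (tangential_expr f a l) p)
  <= 2 * Num.sqrt (ev a p).
Proof.
move=> xy aG.
have h1 := sqr_ge0 x; have h2 := sqr_ge0 y.
set T := vev (grad_expr f l) p.
have x1 : `|x| <= 1.
  by rewrite -sqrtr_sqr -[leRHS]sqrtr1 ler_sqrt//; lra.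
have k1 : `|x ^+ 2 - y ^+ 2| <= 1 by rewrite ler_norml; apply/andP; split; lra.
have U1 : enorm (vev (normal_expr f a) p) <= 3 / 2 * Num.sqrt (ev a p).
  rewrite /enorm edot_normal_expr sqrtrM//.
  rewrite ler_wpM2r ?sqrtr_ge0//.
  have h32 : 0 <= 3 / 2 :> R by lra.
  by rewrite -[leRHS](ger0_norm h32) -sqrtr_sqr ler_sqrt ?sqr_ge0//; lra.
have W1 : enorm (vev (tangential_expr f a l) p) <= 1 / 2 * Num.sqrt (ev a p).
  rewrite vev_tangential_expr enormZ normrM (ger0_norm (ltW a0)) normrN ger0_norm ?invr_ge0//.
  rewrite mul1r -mulrA ler_wpM2l ?invr_ge0//.
  rewrite -[X in X * _](sqr_sqrtr (ltW a0)) expr2 -mulrA ler_piMr ?sqrtr_ge0//.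
  rewrite /enorm -sqrtrM; last exact: ltW.
  rewrite -[leRHS]sqrtr1 ler_sqrt//.
  apply: (@le_trans _ _ (G / 50 * (25 / G))).
    by apply: ler_pM => //; [exact: ltW|exact: edot_ge0|exact: edot_grad_expr].
  rewrite [leLHS](_ : _ = 1/2); first by lra.
  by field; rewrite gt_eqF.
rewrite (le_trans (enormD _ _))// !enormZ.
have : `|x| * enorm (vev (normal_expr f a) p) <= 3 / 2 * Num.sqrt (ev a p).
  by apply: le_trans U1; rewrite ler_piMl ?enorm_ge0.
have : `|x ^+ 2 - y ^+ 2| * enorm (vev (tangential_expr f a l) p) <= 1 / 2 * Num.sqrt (ev a p).
  by apply: le_trans W1; rewrite ler_piMl ?enorm_ge0.
by lra.
Qed.

End Pointwise.

End Corrugation.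

(** * Choice of the wavelength *)

Section Stage.
Context {R : realType}.
Local Notation disk := (@closed_disk R).
Implicit Types (f : vexpr (R := R)) (a G D : expr R) (p : 'rV[R]_2) (l : bool -> R).

Lemma wd_det_expr f : vwd f -> wd (det_expr f).
Proof. by move=> wf; do !split; exact: wd_pd. Qed.

Lemma vwd_normal_expr f a : vwd f -> wd a -> positive_on_disk a ->
  positive_on_disk (det_expr f) -> vwd (normal_expr f a).
Proof.
move=> wf wa pa pdet; apply: vwd_scale; last by apply: vwd_cross; exact: vwd_pd.
split; last by split => //; exact: wd_det_expr.
split => //; split => //.
case: pa => c c0 hc; exists (2 * c) => [|p /hc]; first by rewrite mulr_gt0.
by rewrite /= ler_pM2l.
Qed.

Lemma vwd_tangential_expr f a l : vwd f -> wd a -> positive_on_disk (det_expr f) ->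
  vwd (tangential_expr f a l).
Proof.
move=> wf wa pdet; have wD := wd_det_expr wf.
apply: vwd_scale => //; apply: vwd_scale => //.
by apply: vwd_add; apply: vwd_scale;
  first [exact: vwd_pd|do !split; exact: wd_pd].
Qed.

Lemma vwd_corrugate f a l h : vwd f -> wd a -> positive_on_disk a ->
  positive_on_disk (det_expr f) -> vwd (corrugate f a l h).
Proof.
move=> wf wa pa pdet.
apply: vwd_add => //; apply: vwd_scale; first by do !split.
apply: vwd_add; first exact: vwd_normal_expr.
by apply: vwd_scale; [do !split|exact: vwd_tangential_expr].
Qed.

(** The bounds on f, U, W and their derivatives do not involve the wavelength h; it is chosen after
    them, so that the remainders, which carry a factor h, stay below eps. *)
Lemma corrugation f a (G : 'rV[R]_2 -> R) l (c0 eps : R) :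
  vwd f -> wd a -> positive_on_disk a -> 0 < c0 ->
  (forall p, disk p -> c0 <= G p) ->
  (forall p, disk p -> forall b c, `|metric f b c p - (b == c)%:R * G p| <= G p / 4) ->
  (forall p, disk p -> ev a p <= G p / 50) ->
  l false ^+ 2 + l true ^+ 2 <= 5 -> (forall b, `|l b| <= 2) -> 0 < eps ->
  exists f', [/\ vwd f',
    forall p, disk p -> enorm (vev f' p - vev f p) <= eps,
    forall p, disk p -> forall b,
      enorm (tangent f' b p - tangent f b p) <= 4 * Num.sqrt (ev a p) + eps &
    forall p, disk p -> forall b c,
      `|metric f' b c p - metric f b c p - ev a p * l b * l c|
         <= 25 * ev a p ^+ 2 / G p + eps].
Proof.
move=> wf wa pa c00 Gc0 pin aG l5 lb eps0.
have G0 p : disk p -> 0 < G p by move=> /Gc0; exact: lt_le_trans.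
have a0 p : disk p -> 0 < ev a p.
  by case: pa => c c1 hc /hc; exact: lt_le_trans.
have pdet : positive_on_disk (det_expr f).
  exists (c0 ^+ 2 / 2) => [|p dp]; first by rewrite divr_gt0// exprn_gt0.
  apply: (le_trans _ (det_expr_ge (pin p dp))).
  by rewrite ler_pM2r// lerXn2r ?nnegrE ?Gc0// ltW// G0.
have wfh h : vwd (corrugate f a l h) by exact: vwd_corrugate.
set U := normal_expr f a; set W := tangential_expr f a l.
have wU : vwd U by exact: vwd_normal_expr.
have wW : vwd W by exact: vwd_tangential_expr.
have [MU MU0 hMU] := vev_bounded wU.
have [MW MW0 hMW] := vev_bounded wW.
have [MX MX0 hMX] := vev_bounded (vwd_pd false wf).
have [MY MY0 hMY] := vev_bounded (vwd_pd true wf).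
have [NU NU0 hNU] := vev_bounded (vwd_pd false wU).
have [NW NW0 hNW] := vev_bounded (vwd_pd false wW).
have [NU' NU'0 hNU'] := vev_bounded (vwd_pd true wU).
have [NW' NW'0 hNW'] := vev_bounded (vwd_pd true wW).
pose M := MU + MW + MX + MY + NU + NW + NU' + NW'.
have M0 : 0 < M by rewrite /M; lra.
have hX p b : disk p -> enorm (tangent f b p) <= M.
  by move=> dp; have := hMX p dp; have := hMY p dp; rewrite /tangent /M; case: b; lra.
have hU p : disk p -> enorm (vev U p) <= M.
  by move=> dp; have := hMU p dp; rewrite /M; lra.
have hW p : disk p -> enorm (vev W p) <= M.
  by move=> dp; have := hMW p dp; rewrite /M; lra.
have hdU p b : disk p -> enorm (tangent U b p) <= M.
  by move=> dp; have := hNU p dp; have := hNU' p dp; rewrite /tangent /M; case: b; lra.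
have hdW p b : disk p -> enorm (tangent W b p) <= M.
  by move=> dp; have := hNW p dp; have := hNW' p dp; rewrite /tangent /M; case: b; lra.
(* 2M bounds the displacement and the derivative remainder, both divided by h. For the metric, 24 =
   10 + 10 + 4 comes from two products of vectors of lengths 5M and 2M, and one of two vectors of
   length 2M. *)
pose K := 2 * M + 24 * M ^+ 2.
have K0 : 0 < K by rewrite /K addr_gt0// mulr_gt0// exprn_gt0.
have K2 : 2 * M <= K by rewrite /K lerDl mulr_ge0// sqr_ge0.
have K24 : 24 * M ^+ 2 <= K by rewrite /K lerDr mulr_ge0// ltW.
pose h := eps / (eps + K).
have eK : 0 < eps + K by rewrite addr_gt0.
have h0 : 0 < h by rewrite divr_gt0.
have h1 : h <= 1 by rewrite ler_pdivrMr//; lra.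
have hK : h * K <= eps.
  have : K / (eps + K) <= 1 by rewrite ler_pdivrMr//; lra.
  by move=> /(ler_wpM2l (ltW eps0)); rewrite mulr1 /h -mulrA (mulrC _ K).
have hsc (z : R) (u v : 'rV[R]_3) : enorm u <= M -> enorm v <= M -> `|z| <= 1 ->
    enorm (u + z *: v) <= 2 * M.
  move=> u1 v1 z1; rewrite (le_trans (enormD _ _))// enormZ.
  have : `|z| * enorm v <= 1 * M by rewrite ler_pM ?enorm_ge0.
  by lra.
have hcos x : `|cos x| <= 1 :> R by rewrite ler_norml cos_geN1 cos_le1.
have hsin x : `|sin x| <= 1 :> R by rewrite ler_norml sin_geN1 sin_le1.
have hP p b : disk p -> enorm (sin (ev (phase_expr l h) p) *:
     (tangent U b p + cos (ev (phase_expr l h) p) *: tangent W b p)) <= 2 * M.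
  move=> dp; rewrite enormZ; apply: (@le_trans _ _ (1 * (2 * M))); last by rewrite mul1r.
  by apply: ler_pM; [exact: normr_ge0|exact: enorm_ge0|exact: hsin|apply: hsc; rewrite ?hdU ?hdW].
have e3 (x y z : 'rV[R]_3) : x + y + z - x = y + z.
  by rewrite -(addrA x) [x + _]addrC addrK.
exists (corrugate f a l h); split => // p dp.
- rewrite /corrugate vev_add addrC addKr vev_scale vev_add vev_scale; cbn [ev].
  rewrite -/U -/W enormZ normrM (gtr0_norm h0).
  rewrite (le_trans _ hK)// -mulrA ler_pM2l// (le_trans _ K2)//.
  apply: (@le_trans _ _ (1 * (2 * M))); last by rewrite mul1r.
  by apply: ler_pM => //; [exact: enorm_ge0|apply: hsc; rewrite ?hU ?hW].
- move=> b; rewrite tangent_corrugate ?gt_eqF// -/U -/W.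
  rewrite e3 (le_trans (enormD _ _))// lerD//.
    rewrite enormZ (_ : 4 * Num.sqrt (ev a p) = 2 * (2 * Num.sqrt (ev a p))); last by ring.
    apply: ler_pM => //; first exact: enorm_ge0.
    apply: (enorm_corrugate_main (G0 p dp) (pin p dp) (a0 p dp) l5); last exact: aG.
    by rewrite cos2Dsin2.
  rewrite enormZ (gtr0_norm h0) (le_trans _ hK)// ler_pM2l// (le_trans _ K2)//.
  exact: hP.
- move=> b c; rewrite /metric !tangent_corrugate ?gt_eqF// -/U -/W.
  set x := cos _; set y := sin _.
  set Z := x *: vev U p + _.
  set Hb := y *: _; set Hc := y *: (_ + _ *: tangent W c p).
  have xy : x ^+ 2 + y ^+ 2 = 1 by rewrite cos2Dsin2.
  have Zn : enorm Z <= 2 * M.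
    have := sqr_ge0 x; have := sqr_ge0 y => s1 s2.
    apply: (@le_trans _ _ (1 * M + 1 * M)); last by lra.
    rewrite (le_trans (enormD _ _))// !enormZ lerD// ler_pM ?enorm_ge0 ?hU ?hW ?hcos//.
    by rewrite ler_norml; apply/andP; split; lra.
  have hY d : enorm (tangent f d p + l d *: Z) <= 5 * M.
    rewrite (le_trans (enormD _ _))// enormZ.
    have : `|l d| * enorm Z <= 2 * (2 * M) by rewrite ler_pM ?enorm_ge0.
    by have := hX p d dp; lra.
  have hHb : enorm Hb <= 2 * M by exact: hP.
  have hHc : enorm Hc <= 2 * M by exact: hP.
  have m1 := metric_corrugate_main (G0 p dp) (pin p dp) (a0 p dp) l5 b c xy (erefl _).
  rewrite -/U -/W -/Z in m1.
  set Yb := tangent f b p + l b *: Z; set Yc := tangent f c p + l c *: Z.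
  rewrite -/Yb -/Yc in m1.
  have ab : `|l b * l c| <= 4.
    rewrite normrM (_ : 4 = 2 * 2 :> R); last by ring.
    by rewrite ler_pM.
  have m2 : `|l b * l c| * (25 / 4 * ev a p ^+ 2 / G p) <= 25 * ev a p ^+ 2 / G p.
    apply: (@le_trans _ _ (4 * (25 / 4 * ev a p ^+ 2 / G p))).
      apply: ler_wpM2r => //; apply: divr_ge0; last exact/ltW/G0.
      by apply: mulr_ge0; [lra|exact: sqr_ge0].
    by rewrite [leLHS](_ : _ = 25 * ev a p ^+ 2 / G p)//; field; rewrite gt_eqF// G0.
  have m3 : `|edot (Yb + h *: Hb) (Yc + h *: Hc) - edot Yb Yc| <= eps.
    have -> : edot (Yb + h *: Hb) (Yc + h *: Hc) - edot Yb Yc =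
       h * (edot Yb Hc + edot Hb Yc + h * edot Hb Hc) by rewrite !edotE; ring.
    rewrite normrM (gtr0_norm h0) (le_trans _ hK)// ler_pM2l// (le_trans _ K24)//.
    have n1 : `|edot Yb Hc| <= 5 * M * (2 * M).
      by rewrite (le_trans (normr_edot _ _))// ler_pM ?enorm_ge0 ?hY.
    have n2 : `|edot Hb Yc| <= 2 * M * (5 * M).
      by rewrite (le_trans (normr_edot _ _))// ler_pM ?enorm_ge0 ?hY.
    have n3 : `|h * edot Hb Hc| <= 1 * (2 * M * (2 * M)).
      rewrite normrM ler_pM// ?(gtr0_norm h0)//.
      by rewrite (le_trans (normr_edot _ _))// ler_pM ?enorm_ge0.
    rewrite (le_trans (ler_normD _ _))//.
    have := ler_normD (edot Yb Hc) (edot Hb Yc).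
    by rewrite expr2; lra.
  rewrite -/(metric f b c p) [X in `|X| <= _](_ : _ =
     (edot (Yb + h *: Hb) (Yc + h *: Hc) - edot Yb Yc) +
     (edot Yb Yc - metric f b c p - ev a p * l b * l c)); last by ring.
  by rewrite (le_trans (ler_normD _ _))// addrC lerD// (le_trans m1).
Qed.

End Stage.

(** * One stage of the iteration *)

Section StageStep.
Context {R : realType}.
Local Notation disk := (@closed_disk R).
Implicit Types (f : vexpr (R := R)) (a G D : expr R) (p : 'rV[R]_2).

(** The error is measured against the increment D to be added next. With D / 8, [coef1] and [coef2]
    stay between D / 20 and D. *)
Definition short f G D : Prop := forall p, disk p -> forall b c : bool,
  `|metric f b c p - (b == c)%:R * ev G p| <= ev D p / 8.

Definition defect f G D b : expr R :=
  Subtract (Add G D) (vdot (vpd b f) (vpd b f)).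

(* Coefficients of [(G + D) (dx^2 + dy^2) - f^*<,>] on dx^2, (dx + 2dy)^2 and
   (dx - 2dy)^2. *)
Definition coef1 f G D : expr R := Subtract (defect f G D false) (Mul (Cst 4^-1) (defect f G D true)).
Definition coef2 (e : R) f G D : expr R :=
  Add (Mul (Cst 8^-1) (defect f G D true))
      (Mul (Cst (- e / 4)) (vdot (vpd false f) (vpd true f))).

Definition dir (x y : R) (b : bool) : R := if b then y else x.

Lemma ev_defect f G D b p : ev (defect f G D b) p = ev G p + ev D p - metric f b b p.
Proof. by rewrite /defect /Subtract; cbn [ev]; rewrite ev_vdot mulN1r. Qed.

Lemma ev_coef1 f G D p : ev (coef1 f G D) p =
  (ev G p + ev D p - metric f false false p) - 4^-1 * (ev G p + ev D p - metric f true true p).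
Proof. by rewrite /coef1 /Subtract; cbn [ev]; rewrite !ev_defect mulN1r. Qed.

Lemma ev_coef2 e f G D p : ev (coef2 e f G D) p =
  8^-1 * (ev G p + ev D p - metric f true true p) + - e / 4 * metric f false true p.
Proof. by rewrite /coef2; cbn [ev]; rewrite !ev_defect ev_vdot. Qed.

(** As a <= D <= G / 10^4, the quadratic error 25 a^2 / G is at most D / 400. The tolerance 20 D
    leaves room for the terms already added within the same stage. *)
Lemma corrugation_step f a (G D : 'rV[R]_2 -> R) (x y c0 eps : R) :
  vwd f -> wd a -> 0 < c0 -> 0 < eps ->
  (forall p, disk p -> c0 <= D p /\ D p <= G p / 10 / 10 / 10 / 10 /\ D p / 20 <= ev a p <= D p) ->
  (forall p, disk p -> forall b c : bool, `|metric f b c p - (b == c)%:R * G p| <= 20 * D p) ->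
  x ^+ 2 + y ^+ 2 <= 5 -> `|x| <= 2 -> `|y| <= 2 ->
  exists f', [/\ vwd f',
    forall p, disk p -> enorm (vev f' p - vev f p) <= eps,
    forall p, disk p -> forall b,
      enorm (tangent f' b p - tangent f b p) <= 4 * Num.sqrt (D p) + eps &
    forall p, disk p -> forall b c,
      `|metric f' b c p - metric f b c p - ev a p * dir x y b * dir x y c|
         <= D p / 20 / 20 + eps].
Proof.
move=> wf wa c00 eps0 hD pin xy x2 y2.
have D0 p : disk p -> 0 < D p by move=> /hD[+ _]; exact: lt_le_trans.
have G0 p : disk p -> 0 < G p by move=> dp; have [_ [h _]] := hD p dp; have := D0 p dp; lra.
have [//|//||//||||//||//|f' [wf' h1 h2 h3]] := @corrugation R f a G (dir x y) c0 eps.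
- exists (c0 / 20) => [|p dp]; first by rewrite divr_gt0.
  by have [h1 [h2 /andP[h3 h4]]] := hD p dp; lra.
- by move=> p dp; have [h1 [h2 /andP[h3 h4]]] := hD p dp; have := G0 p dp; lra.
- move=> p dp b c; have [h1 [h2 /andP[h3 h4]]] := hD p dp.
  by apply: (le_trans (pin p dp b c)); have := D0 p dp; lra.
- by move=> p dp; have [h1 [h2 /andP[h3 h4]]] := hD p dp; have := G0 p dp; lra.
- by case.
exists f'; split => // p dp.
- move=> b; apply: (le_trans (h2 p dp b)).
  have [_ [_ /andP[_ h]]] := hD p dp.
  by rewrite lerD2r ler_pM2l// ler_sqrt// ltW// D0.
- move=> b c; apply: (le_trans (h3 p dp b c)); rewrite lerD2r.
  have [h4 [h5 /andP[h6 h7]]] := hD p dp.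
  have d0 := D0 p dp; have g0 := G0 p dp.
  rewrite ler_pdivrMr// expr2.
  have : ev a p * ev a p <= D p * (G p / 10 / 10 / 10 / 10).
    by apply: ler_pM => //; lra.
  by lra.
Qed.

(** The three coefficients are computed once, from f, and not from the intermediate maps. Each
    corrugation then errs by at most D / 400 + e, and the total is below D' / 8 because D <= 2
    D'. *)
Lemma stage f G D D' eps : vwd f -> wd G -> wd D ->
  positive_on_disk D -> positive_on_disk D' ->
  (forall p, disk p -> ev D p <= ev G p / 10 / 10 / 10 / 10) ->
  (forall p, disk p -> ev D p <= 2 * ev D' p) ->
  short f G D -> 0 < eps ->
  exists f', [/\ vwd f',
    forall p, disk p -> enorm (vev f' p - vev f p) <= eps,
    forall p, disk p -> forall b,
      enorm (tangent f' b p - tangent f b p) <= 13 * Num.sqrt (ev D p) &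
    short f' (Add G D) D'].
Proof.
move=> wf wG wD [c c0 hc] [c' c'0 hc'] DG DD' sf eps0.
have D0 p : disk p -> 0 < ev D p by move=> /hc; exact: lt_le_trans.
(* The four bounds control the total displacement, the errors relative to D, the errors relative to
   D', and the step from 12 sqrt D + 3 e to 13 sqrt D. *)
pose e := Num.min (eps / 3) (Num.min (c / 20 / 20) (Num.min (c' / 20 / 20) (Num.sqrt c / 3))).
have e0 : 0 < e by rewrite !lt_min; do 3?[apply/andP; split]; rewrite ?divr_gt0 ?sqrtr_gt0.
have [e1 e2 e3 e4] : [/\ e <= eps / 3, e <= c / 20 / 20, e <= c' / 20 / 20 & e <= Num.sqrt c / 3].
  by split; rewrite /e ?ge_min ?lexx ?orbT.
pose a1 := coef1 f G D; pose a2 := coef2 1 f G D; pose a3 := coef2 (-1) f G D.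
have a1E p := ev_coef1 f G D p : ev a1 p = _.
have a2E p := ev_coef2 1 f G D p : ev a2 p = _.
have a3E p := ev_coef2 (-1) f G D p : ev a3 p = _.
have wa1 : wd a1 by rewrite /a1 /coef1; do !split => //; exact: wd_pd.
have wa2 : wd a2 by do !split => //; exact: wd_pd.
have wa3 : wd a3 by do !split => //; exact: wd_pd.
clearbody e a1 a2 a3.
have bnd p : disk p -> [/\ ev D p / 20 <= ev a1 p <= ev D p,
    ev D p / 20 <= ev a2 p <= ev D p & ev D p / 20 <= ev a3 p <= ev D p].
  move=> dp; have := sf p dp false false; have := sf p dp true true.
  have := sf p dp false true; have := D0 p dp.
  rewrite a1E a2E a3E /= !ler_norml; clear => d0 /andP[? ?] /andP[? ?] /andP[? ?].
  by split; apply/andP; split; lra.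
have hyp a : (forall p, disk p -> ev D p / 20 <= ev a p <= ev D p) ->
   forall p, disk p -> c <= ev D p /\ ev D p <= ev G p / 10 / 10 / 10 / 10 /\ ev D p / 20 <= ev a p <= ev D p.
  by move=> ha p dp; split; [exact: hc|split; [exact: DG|exact: ha]].
have eD p : disk p -> e <= ev D p / 20 / 20 by move=> /hc; lra.
have [||||f1 [wf1 f1a f1b f1c]] := @corrugation_step f a1 (ev G) (ev D) 1 0 c e wf wa1 c0 e0
    (hyp a1 (fun p dp => let: And3 h _ _ := bnd p dp in h)).
- by move=> p dp b b'; apply: (le_trans (sf p dp b b')); have := D0 p dp; lra.
- by rewrite expr1n expr0n /=; lra.
- by rewrite normr1; lra.
- by rewrite normr0; lra.
have pin1 p : disk p -> forall b b' : bool,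
    `|metric f1 b b' p - (b == b')%:R * ev G p| <= 2 * ev D p.
  move=> dp b b'; have := sf p dp b b'; have := f1c p dp b b'.
  have := eD p dp; have [+ _ _] := bnd p dp; have := D0 p dp.
  by case: b b' => -[]; rewrite /dir /= !ler_norml; clear;
    move=> ? /andP[? ?] ? /andP[? ?] /andP[? ?]; apply/andP; split; lra.
have [||||f2 [wf2 f2a f2b f2c]] := @corrugation_step f1 a2 (ev G) (ev D) 1 2 c e wf1 wa2 c0 e0
    (hyp a2 (fun p dp => let: And3 _ h _ := bnd p dp in h)).
- by move=> p dp b b'; apply: (le_trans (pin1 p dp b b')); have := D0 p dp; lra.
- by rewrite expr1n expr2; lra.
- by rewrite normr1; lra.
- by rewrite ger0_norm.
have pin2 p : disk p -> forall b b' : bool,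
    `|metric f2 b b' p - (b == b')%:R * ev G p| <= 10 * ev D p.
  move=> dp b b'; have := pin1 p dp b b'; have := f2c p dp b b'.
  have := eD p dp; have [_ + _] := bnd p dp; have := D0 p dp.
  by case: b b' => -[]; rewrite /dir /= !ler_norml; clear;
    move=> ? /andP[? ?] ? /andP[? ?] /andP[? ?]; apply/andP; split; lra.
have [||||f3 [wf3 f3a f3b f3c]] := @corrugation_step f2 a3 (ev G) (ev D) 1 (-2) c e wf2 wa3 c0 e0
    (hyp a3 (fun p dp => let: And3 _ _ h := bnd p dp in h)).
- by move=> p dp b b'; apply: (le_trans (pin2 p dp b b')); have := D0 p dp; lra.
- by rewrite expr1n expr2; lra.
- by rewrite normr1; lra.
- by rewrite normrN ger0_norm.
exists f3; split => // p dp.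
- have -> : vev f3 p - vev f p = (vev f3 p - vev f2 p) + (vev f2 p - vev f1 p) + (vev f1 p - vev f p).
    by rewrite !addrA !subrK.
  rewrite (le_trans (enormD _ _))//.
  have := enormD (vev f3 p - vev f2 p) (vev f2 p - vev f1 p).
  by have := f1a p dp; have := f2a p dp; have := f3a p dp; lra.
- move=> b.
  have -> : tangent f3 b p - tangent f b p = (tangent f3 b p - tangent f2 b p) +
      (tangent f2 b p - tangent f1 b p) + (tangent f1 b p - tangent f b p).
    by rewrite !addrA !subrK.
  rewrite (le_trans (enormD _ _))//.
  have := enormD (tangent f3 b p - tangent f2 b p) (tangent f2 b p - tangent f1 b p).
  have := f1b p dp b; have := f2b p dp b; have := f3b p dp b.
  have : Num.sqrt c <= Num.sqrt (ev D p) by rewrite ler_sqrt ?hc// ltW// D0.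
  by lra.
- move=> b b'.
  have {}eD' : e <= ev D' p / 20 / 20 by have := hc' p dp; lra.
  have := f1c p dp b b'; have := f2c p dp b b'; have := f3c p dp b b'.
  have := DD' p dp; rewrite a1E a2E a3E -/(ev G p + ev D p).
  have mC : metric f true false p = metric f false true p by rewrite /metric edotC.
  move: eD'; case: b b' => -[]; rewrite /dir /= ?mC !ler_norml; clear.
  all: by move=> ? ? /andP[? ?] /andP[? ?] /andP[? ?]; apply/andP; split; lra.
Qed.

End StageStep.

(** * Mean value estimates and local injectivity *)

Section MeanValue.
Context {R : realType}.
Local Notation disk := (@closed_disk R).
Implicit Types (f : vexpr (R := R)) (G D : expr R) (p q v z : 'rV[R]_2).

(** For vector values the intermediate point depends on the test vector w; w is taken below to be
    the vector to estimate, or an approximation of it. *)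
Lemma vev_mvt f (w : 'rV[R]_3) p q : vwd f -> disk p -> disk q ->
  exists z, [/\ disk z, forall r, enorm p <= r -> enorm q <= r -> enorm z <= r,
    enorm (z - p) <= enorm (q - p) &
    edot w (vev f q - vev f p) =
    edot w ((q - p) 0 0 *: tangent f false z + (q - p) 0 1 *: tangent f true z)].
Proof.
move=> wf dp dq; pose e := vdot (fun i => Cst (w 0 i)) f.
have we : wd e by apply: wd_dot.
have wE : vev (fun i => Cst (w 0 i)) = fun=> w.
  by apply/funext => z; apply/rowP => i; rewrite !mxE.
have [z [dz h1 h2 h]] := ev_mvt we dp dq; exists z; split => //.
rewrite edotDr edotNr; move: h; rewrite !ev_vdot wE => ->.
rewrite /dir_deriv /= !edotE !edot3 /tangent !mxE; ring.
Qed.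

Lemma vev_mean_le f (B r : R) p q : vwd f -> disk p -> disk q ->
  enorm p <= r -> enorm q <= r ->
  (forall z b, disk z -> enorm z <= r -> enorm (tangent f b z) <= B) ->
  enorm (vev f q - vev f p) <= 2 * B * enorm (q - p).
Proof.
move=> wf dp dq pr qr hB; set w := vev f q - vev f p.
have [w0|w0] := eqVneq (enorm w) 0.
  rewrite w0 mulr_ge0 ?enorm_ge0// mulr_ge0//.
  by rewrite (le_trans (enorm_ge0 (tangent f false p)))// hB.
have [z [dz zr _ h]] := vev_mvt w wf dp dq.
have wp : 0 < enorm w by rewrite lt_def w0 enorm_ge0.
rewrite -(ler_pM2l wp) -expr2 sqr_enorm {2}/w h (le_trans (edot_le_enorm _ _))// ler_pM2l//.
rewrite (le_trans (enormD _ _))// !enormZ.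
have := zr r pr qr => {}zr.
have h0 : `|(q - p) 0 0| * enorm (tangent f false z) <= enorm (q - p) * B.
  by rewrite ler_pM ?enorm_ge0 ?enorm_coord ?hB.
have h1 : `|(q - p) 0 1| * enorm (tangent f true z) <= enorm (q - p) * B.
  by rewrite ler_pM ?enorm_ge0 ?enorm_coord ?hB.
by rewrite (le_trans (lerD h0 h1))//; lra.
Qed.

Lemma vev_lipschitz f : vwd f -> exists2 M, 0 < M &
  forall p q, disk p -> disk q -> enorm (vev f q - vev f p) <= M * enorm (q - p).
Proof.
move=> wf; have [M M0 hM] := vev_bounded (vwd_pd false wf).
have [N N0 hN] := vev_bounded (vwd_pd true wf).
exists (2 * (M + N)) => [|p q dp dq]; first by rewrite mulr_gt0// addr_gt0.
apply: (@vev_mean_le f _ 1) => // z b dz _.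
by have := hM z dz; have := hN z dz; rewrite /tangent; case: b; lra.
Qed.

Definition vsub f g : vexpr (R := R) := fun i => Subtract (f i) (g i).

Lemma vwd_sub f g : vwd f -> vwd g -> vwd (vsub f g).
Proof. by move=> wf wg i; do !split. Qed.

Lemma vev_sub f g p : vev (vsub f g) p = vev f p - vev g p.
Proof. by apply/rowP => i; rewrite !mxE /= mulN1r. Qed.

Lemma tangent_sub f g b p : tangent (vsub f g) b p = tangent f b p - tangent g b p.
Proof. by apply/rowP => i; rewrite !mxE /=; ring. Qed.

(** The radius rho depends on f alone, although f' may oscillate arbitrarily fast: the tangents of
    f' stay close to those of f, which vary little at scale rho. The linear part at p expands by
    9/10 sqrt G, the errors take away at most 1/2 sqrt G, and 2/5 remains. *)
Lemma local_injectivity f G D c0 : vwd f -> wd G -> 0 < c0 ->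
  (forall p, disk p -> c0 <= ev G p) ->
  (forall p, disk p -> ev D p <= ev G p / 10 / 10 / 10 / 10) ->
  (forall p, disk p -> forall b c : bool,
     `|metric f b c p - (b == c)%:R * ev G p| <= ev D p / 8) ->
  exists2 rho, 0 < rho & forall f', vwd f' ->
    (forall p, disk p -> forall b,
       enorm (tangent f' b p - tangent f b p) <= 13 * Num.sqrt (ev D p)) ->
    forall p q, disk p -> disk q -> enorm (q - p) <= rho ->
      2 / 5 * Num.sqrt c0 * enorm (q - p) <= enorm (vev f' q - vev f' p).
Proof.
move=> wf wG c00 hG hD hf.
have [K0 K00 hK0] := vev_lipschitz (vwd_pd false wf).
have [K1 K10 hK1] := vev_lipschitz (vwd_pd true wf).
have [L L0 hL] := ev_lipschitz wG.
have s00 : 0 < Num.sqrt c0 by rewrite sqrtr_gt0.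
pose rho := Num.min (Num.sqrt c0 / 20 / (K0 + K1)) (c0 / 5 / L).
have K01 : 0 < K0 + K1 by rewrite addr_gt0.
have rho0 : 0 < rho by rewrite lt_min !divr_gt0.
have rho1 : (K0 + K1) * rho <= Num.sqrt c0 / 20.
  by rewrite mulrC -ler_pdivlMr// ge_min lexx.
have rho2 : L * rho <= c0 / 5.
  by rewrite mulrC -ler_pdivlMr// ge_min lexx orbT.
exists rho => // f' wf' hf' p q dp dq pq.
set v := q - p; set s := Num.sqrt (ev G p).
have g0 : c0 <= ev G p by exact: hG.
have gp : 0 < ev G p by exact: lt_le_trans g0.
have s0 : 0 < s by rewrite sqrtr_gt0.
have s2 : s ^+ 2 = ev G p by rewrite sqr_sqrtr// ltW.
have sc : Num.sqrt c0 <= s by rewrite ler_sqrt// ltW.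
(* 70 instead of 100 absorbs the variation of G from p to z: 6/5 / 10^4 <= 1 / 70^2. *)
have dz_le z : disk z -> enorm (z - p) <= enorm v -> Num.sqrt (ev D z) <= s / 70.
  move=> dz zp; have s70 : 0 <= s / 70 by rewrite divr_ge0// ltW.
  rewrite -[leRHS](ger0_norm s70) -sqrtr_sqr.
  rewrite ler_sqrt ?sqr_ge0//; apply: (le_trans (hD z dz)).
  have : ev G z <= ev G p + c0 / 5.
    have := hL p z dp dz; rewrite ler_norml => /andP[_].
    have : L * enorm (z - p) <= L * rho by rewrite ler_pM2l// (le_trans zp).
    by lra.
  by rewrite expr_div_n s2 expr2; lra.
(* 13/70 + 1/20 <= 1/4. *)
have tz z b : disk z -> enorm (z - p) <= enorm v ->
    enorm (tangent f' b z - tangent f b p) <= s / 4.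
  move=> dz zp.
  have -> : tangent f' b z - tangent f b p =
    (tangent f' b z - tangent f b z) + (tangent f b z - tangent f b p).
    by rewrite addrA subrK.
  apply: (le_trans (enormD _ _)).
  have h1 := hf' z dz b.
  have h2 := dz_le z dz zp.
  have h3 : enorm (tangent f b z - tangent f b p) <= (K0 + K1) * rho.
    have zr : enorm (z - p) <= rho by exact: le_trans pq.
    have := enorm_ge0 (z - p) => z0.
    have k0 : 0 <= K0 * enorm (z - p) by rewrite mulr_ge0// ltW.
    have k1 : 0 <= K1 * enorm (z - p) by rewrite mulr_ge0// ltW.
    have k2 : (K0 + K1) * enorm (z - p) <= (K0 + K1) * rho by rewrite ler_pM2l.
    rewrite mulrDl in k2; rewrite /tangent; case: b {h1}.
      by have := hK1 p z dp dz; lra.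
    by have := hK0 p z dp dz; lra.
  by lra.
pose w := v 0 0 *: tangent f false p + v 0 1 *: tangent f true p.
have w_ge : 9 / 10 * s * enorm v <= enorm w.
  have sv0 : 0 <= 9 / 10 * s * enorm v.
    by apply: mulr_ge0; [apply: mulr_ge0; [lra|exact: ltW]|exact: enorm_ge0].
  rewrite -(@ler_pXn2r _ 2) ?nnegrE ?enorm_ge0//.
  rewrite !exprMn s2 !sqr_enorm edot2 /w !edotE.
  have mC : metric f true false p = metric f false true p by rewrite /metric edotC.
  rewrite -/(metric f false false p) -/(metric f false true p).
  rewrite -/(metric f true false p) -/(metric f true true p) mC.
  have := hf p dp false false; have := hf p dp true true; have := hf p dp false true.
  have := hD p dp.
  move: (metric f false false p) (metric f true true p) (metric f false true p) => E H F.
  move: (ev D p) (ev G p) gp (v 0 0) (v 0 1); clear => d g gp' x y dg.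
  rewrite /= !ler_norml => /andP[F1 F2] /andP[H1 H2] /andP[E1 E2].
  have q1 : 0 <= (E - 99 / 100 * g) * (x ^+ 2) by rewrite mulr_ge0 ?sqr_ge0//; lra.
  have q2 : 0 <= (H - 99 / 100 * g) * (y ^+ 2) by rewrite mulr_ge0 ?sqr_ge0//; lra.
  have q3 : 0 <= (F + g / 100) * ((x + y) ^+ 2) by rewrite mulr_ge0 ?sqr_ge0//; lra.
  have q4 : 0 <= (g / 100 - F) * ((x - y) ^+ 2) by rewrite mulr_ge0 ?sqr_ge0//; lra.
  have q5 : 0 <= g * x ^+ 2 by rewrite mulr_ge0 ?sqr_ge0//; lra.
  have q6 : 0 <= g * y ^+ 2 by rewrite mulr_ge0 ?sqr_ge0//; lra.
  by lra.
have [v0|v0] := eqVneq (enorm v) 0; first by rewrite v0 mulr0 enorm_ge0.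
have vp : 0 < enorm v by rewrite lt_def v0 enorm_ge0.
have wp : 0 < enorm w by apply: lt_le_trans w_ge; rewrite !mulr_gt0//; lra.
have [z [dz _ zp h]] := vev_mvt w wf' dp dq; rewrite -/v in zp h.
set e0 := tangent f' false z - tangent f false p.
set e1 := tangent f' true z - tangent f true p.
have wE : v 0 0 *: tangent f' false z + v 0 1 *: tangent f' true z =
    w + (v 0 0 *: e0 + v 0 1 *: e1).
  rewrite /w /e0 /e1 !scalerBr addrACA.
  by congr (_ + _); rewrite addrC subrK.
have err : enorm (v 0 0 *: e0 + v 0 1 *: e1) <= s / 2 * enorm v.
  rewrite (le_trans (enormD _ _))// !enormZ.
  have h0 : `|v 0 0| * enorm e0 <= enorm v * (s / 4).
    by rewrite ler_pM ?enorm_ge0 ?enorm_coord ?tz.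
  have h1 : `|v 0 1| * enorm e1 <= enorm v * (s / 4).
    by rewrite ler_pM ?enorm_ge0 ?enorm_coord ?tz.
  by rewrite (le_trans (lerD h0 h1))//; lra.
have main : enorm w * (enorm w - s / 2 * enorm v) <= enorm w * enorm (vev f' q - vev f' p).
  apply: (le_trans _ (edot_le_enorm _ _)); rewrite h wE edotDr -sqr_enorm mulrBr expr2.
  rewrite lerD2l lerNl -edotNr (le_trans (edot_le_enorm _ _))// enormN ler_pM2l//.
rewrite ler_pM2l// in main.
have : Num.sqrt c0 * enorm v <= s * enorm v by rewrite ler_pM2r.
by lra.
Qed.

End MeanValue.

(** * Conformal factors *)

Section ConformalFactors.
Context {R : realType}.
Local Notation disk := (@closed_disk R).

(** [ratio] is the square of [rate], so that in the interior the square roots of the metric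
    increments decay like rate^k. The value 10^-5 gives 1 / ratio^2 <= 1 + 10^-4. *)
Definition rate : R := 1 - 1 / 10 / 10 / 10 / 10 / 10.
(* [ratio] and [offset0] are locked because unification would otherwise unfold
   them to products and quotients. *)
Definition ratio : R := locked (rate ^+ 2).
Definition offset0 : R := locked (16 / (1 - ratio)).
Definition offset (k : nat) : R := offset0 * ratio ^+ k.

Lemma ratioE : ratio = rate ^+ 2. Proof. by rewrite /ratio -lock. Qed.

Lemma offset0E : offset0 = 16 / (1 - ratio). Proof. by rewrite /offset0 -lock. Qed.

Lemma rate_bounds : 0 < rate /\ rate < 1.
Proof. by rewrite /rate; split; lra. Qed.

Lemma ratio_bounds : 0 < ratio /\ ratio < 1.
Proof.
have [r0 r1] := rate_bounds; rewrite ratioE exprn_gt0//; split => //.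
by rewrite exprn_ilt1// ltW.
Qed.

Lemma ratio_sqr_ge : 1 - 4 / 10 / 10 / 10 / 10 / 10 <= ratio ^+ 2.
Proof.
have [r0 r1] := rate_bounds.
pose h : R := 1 / 10 / 10 / 10 / 10 / 10.
have -> : ratio = (1 - h) ^+ 2 by rewrite ratioE.
have h0 : 0 <= h by rewrite /h; lra.
have -> : 1 - 4 / 10 / 10 / 10 / 10 / 10 = 1 - 4 * h by rewrite /h; lra.
have h1 : 1 - 2 * h <= (1 - h) ^+ 2 by have := sqr_ge0 h; lra.
have h2 : 0 <= 1 - 2 * h by rewrite /h; lra.
have : (1 - 2 * h) ^+ 2 <= (1 - h) ^+ 2 ^+ 2 by rewrite lerXn2r ?nnegrE//; lra.
by apply: le_trans; have := sqr_ge0 h; lra.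
Qed.

Lemma offset0_gt0 : 0 < offset0.
Proof. by have [_ q1] := ratio_bounds; rewrite offset0E divr_gt0// subr_gt0. Qed.

Lemma offset_gt0 k : 0 < offset k.
Proof. by have [q0 _] := ratio_bounds; rewrite mulr_gt0 ?offset0_gt0// exprn_gt0. Qed.

Lemma offsetS k : offset k.+1 = ratio * offset k.
Proof. by rewrite /offset exprS mulrCA. Qed.

Implicit Types (u a : R).

Definition factor (z : R) : R := 4 / z ^+ 2.

Lemma factor_sub (y z : R) : 0 < y -> 0 < z ->
  factor y - factor z = 4 * ((z - y) * (z + y)) / (z ^+ 2 * y ^+ 2).
Proof. by move=> y0 z0; rewrite /factor; field; rewrite !gt_eqF. Qed.

Lemma factor_gap_ge u a : 0 <= u <= 1 -> 0 < a ->
  4 * ((a - ratio * a) * a) / ((1 + a) ^+ 2 * (1 + a) ^+ 2)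
     <= factor (u + ratio * a) - factor (u + a).
Proof.
move=> /andP[u0 u1] a0; have [q0 q1] := ratio_bounds.
have qa0 : 0 < ratio * a by rewrite mulr_gt0.
have qa : ratio * a <= a by rewrite ler_piMl// ltW.
rewrite factor_sub; [|lra|lra].
apply: ler_pM.
- by rewrite mulr_ge0// mulr_ge0//; lra.
- by rewrite invr_ge0 mulr_ge0// sqr_ge0.
- rewrite ler_pM2l// (_ : u + a - (u + ratio * a) = a - ratio * a); last by ring.
  by rewrite ler_wpM2l//; lra.
- rewrite lef_pV2 ?posrE; last 2 first.
  + by rewrite mulr_gt0// exprn_gt0//; lra.
  + by rewrite mulr_gt0// exprn_gt0//; lra.
  by apply: ler_pM; rewrite ?sqr_ge0// lerXn2r ?nnegrE//; lra.
Qed.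

(** Since u + ratio * a >= ratio * (u + a), the factor is multiplied by at most 1 / ratio^2, even on
    the boundary u = 0. *)
Lemma factor_gap_le u a : 0 <= u -> 0 < a ->
  factor (u + ratio * a) - factor (u + a) <= factor (u + a) / 10 / 10 / 10 / 10.
Proof.
move=> u0 a0; have [q0 q1] := ratio_bounds; have q2 := ratio_sqr_ge.
have qa0 : 0 < ratio * a by rewrite mulr_gt0.
have z0 : 0 < u + a by lra.
have y0 : 0 < u + ratio * a by lra.
have yz : ratio * (u + a) <= u + ratio * a.
  by rewrite mulrDr lerD2r ler_piMl// ltW.
have y2 : ratio ^+ 2 * (u + a) ^+ 2 <= (u + ratio * a) ^+ 2.
  have qz0 := mulr_ge0 (ltW q0) (ltW z0).
  by rewrite -exprMn lerXn2r ?nnegrE// ltW.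
have : factor (u + ratio * a) <= factor (u + a) / ratio ^+ 2.
  rewrite /factor -mulrA ler_pM2l// -invfM lef_pV2 ?posrE ?mulr_gt0 ?exprn_gt0//.
  by rewrite mulrC.
have f0 : 0 < factor (u + a) by rewrite divr_gt0// exprn_gt0.
have : factor (u + a) / ratio ^+ 2 <= factor (u + a) * (1 + 1 / 10 / 10 / 10 / 10).
  by rewrite ler_pM2l// -[leLHS]mul1r ler_pdivrMr ?exprn_gt0//; lra.
by lra.
Qed.

(** In [factor_sub], the numerator shrinks at most by ratio^2 >= 1/2 and the denominator decreases.
    An error small against one increment is therefore small against the next. *)
Lemma factor_gap_next u a : 0 <= u -> 0 < a ->
  factor (u + ratio * a) - factor (u + a) <=
  2 * (factor (u + ratio * (ratio * a)) - factor (u + ratio * a)).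
Proof.
move=> u0 a0; have [q0 q1] := ratio_bounds; have q2 := ratio_sqr_ge.
have b0 : 0 < ratio * a by rewrite mulr_gt0.
have c0 : 0 < ratio * (ratio * a) by rewrite mulr_gt0.
have ba : ratio * a <= a by rewrite ler_piMl// ltW.
have cb : ratio * (ratio * a) <= ratio * a by rewrite ler_piMl// ltW.
rewrite !factor_sub; [|lra..].
rewrite (_ : u + a - (u + ratio * a) = a - ratio * a); last by ring.
rewrite (_ : u + ratio * a - (u + ratio * (ratio * a)) = ratio * (a - ratio * a)); last by ring.
set z := u + a; set y := u + ratio * a; set x := u + ratio * (ratio * a).
have x0 : 0 < x by rewrite /x; lra.
have y0 : 0 < y by rewrite /y; lra.
have z0 : 0 < z by rewrite /z; lra.
have xz : x <= z by rewrite /x /z; lra.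
have yx : ratio * (z + y) <= y + x.
  have : ratio * u <= u by rewrite ler_piMl// ltW.
  by rewrite /x /y /z; lra.
have d0 : 0 <= a - ratio * a by lra.
rewrite ler_pdivrMr ?mulr_gt0 ?exprn_gt0//.
rewrite (_ : _ * (z ^+ 2 * y ^+ 2) =
   2 * (4 * (ratio * (a - ratio * a) * (y + x))) * (z ^+ 2 / x ^+ 2)); last first.
  by field; rewrite !gt_eqF.
have zx : 1 <= z ^+ 2 / x ^+ 2.
  by rewrite ler_pdivlMr ?exprn_gt0// mul1r lerXn2r ?nnegrE// ltW.
have h1 : (a - ratio * a) * (ratio ^+ 2 * (z + y)) <= ratio * (a - ratio * a) * (y + x).
  rewrite [X in X * (y + x)]mulrC -[leRHS]mulrA ler_wpM2l// expr2 -mulrA ler_pM2l//.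
have h2 : (a - ratio * a) * (z + y) <= 2 * ((a - ratio * a) * (ratio ^+ 2 * (z + y))).
  rewrite mulrCA ler_wpM2l// mulrA ler_peMl//; lra.
have h3 : 0 <= ratio * (a - ratio * a) * (y + x).
  by rewrite mulr_ge0 ?mulr_ge0// ?ltW// addr_gt0.
have h4 : 0 <= 2 * (4 * (ratio * (a - ratio * a) * (y + x))) by lra.
by have := ler_peMr h4 zx; lra.
Qed.

Lemma factor_le_limit u a : 0 < u -> 0 < a -> factor u - factor (u + a) <= 8 * a / u ^+ 3.
Proof.
move=> u0 a0; have z0 : 0 < u + a by lra.
rewrite factor_sub//.
rewrite (_ : u + a - u = a); last by ring.
rewrite (_ : 8 * a / u ^+ 3 = (8 * a * (u + a) * (u + a) / u) / ((u + a) ^+ 2 * u ^+ 2)); last first.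
  by field; rewrite !gt_eqF.
rewrite ler_pM2r ?invr_gt0 ?mulr_gt0 ?exprn_gt0//.
have -> : 8 * a * (u + a) * (u + a) / u = 8 * a * (u + a) + 8 * a * (u + a) * (a / u).
  by field; rewrite gt_eqF.
have : 0 <= 8 * a * (u + a) * (a / u).
  by rewrite mulr_ge0 ?divr_ge0 ?ltW// mulr_gt0 ?mulr_gt0//; lra.
have : 0 <= a * a by rewrite mulr_ge0// ltW.
by lra.
Qed.

(** The constant is the value of the factor at the centre of the disk, u = 1. To leading order the
    factor varies by 8 / offset0^3 over the disk, while offset0 (1 - ratio) = 16 makes the first
    increment 128 / offset0^3, an eighth of which is twice as much. *)
Lemma factor_init u : 0 <= u <= 1 ->
  `|(2 / (offset0 + 1)) ^+ 2 - factor (u + offset0)| <=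
  (factor (u + ratio * offset0) - factor (u + offset0)) / 8.
Proof.
move=> /andP[u0 u1]; have [q0 q1] := ratio_bounds; have A0 := offset0_gt0.
have AE : offset0 - ratio * offset0 = 16.
  by rewrite offset0E; field; rewrite subr_eq0 gt_eqF.
have b0 : 0 < ratio * offset0 by rewrite mulr_gt0.
have -> : (2 / (offset0 + 1)) ^+ 2 = factor (offset0 + 1).
  by rewrite /factor expr_div_n; congr (_ / _); rewrite expr2; lra.
rewrite ler0_norm; last first.
  rewrite subr_le0 /factor ler_pM2l// lef_pV2 ?posrE ?exprn_gt0//; [|lra|lra].
  by rewrite lerXn2r ?nnegrE//; lra.
rewrite opprB !factor_sub; [|lra..].
set A := offset0 in A0 AE b0 *; set z := u + A; set y := u + ratio * A.
have z0 : 0 < z by rewrite /z; lra.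
have y0 : 0 < y by rewrite /y; lra.
have A1 : 0 < A + 1 by lra.
rewrite (_ : z - y = 16); last by rewrite /z /y -AE; ring.
have h1 : 4 * ((A + 1 - z) * (A + 1 + z)) / ((A + 1) ^+ 2 * z ^+ 2) <= 8 / ((A + 1) * z ^+ 2).
  rewrite ler_pdivrMr ?mulr_gt0 ?exprn_gt0//.
  rewrite (_ : 8 / _ * _ = 8 * (A + 1)); last by field; rewrite !gt_eqF.
  have : (A + 1 - z) * (A + 1 + z) <= 1 * (2 * (A + 1)) by apply: ler_pM; rewrite /z; lra.
  by lra.
apply: (le_trans h1).
rewrite (_ : 4 * _ / _ / 8 = 8 / z ^+ 2 * ((z + y) / y ^+ 2)); last by field; rewrite !gt_eqF.
rewrite (_ : 8 / _ = 8 / z ^+ 2 * (A + 1)^-1); last by field; rewrite !gt_eqF.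
rewrite ler_pM2l ?divr_gt0 ?exprn_gt0// ler_pdivlMr ?exprn_gt0// mulrC ler_pdivrMr//.
have : y * y <= (z + y) * (A + 1) by apply: ler_pM; rewrite /z /y; lra.
by rewrite expr2.
Qed.

End ConformalFactors.

(** * The sequence of approximations *)

Section Iteration.
Context {R : realType}.
Local Notation disk := (@closed_disk R).
Local Notation offset := (@offset R).
Local Notation ratio := (@ratio R).
Local Notation rate := (@rate R).
Implicit Types (p q : 'rV[R]_2) (k : nat) (f : vexpr (R := R)).

Definition height p : R := 1 - edot p p.

Lemma height_bounds p : disk p -> 0 <= height p <= 1.
Proof.
rewrite /height -sqr_enorm => dp; have := enorm_ge0 p => p0.
have : enorm p ^+ 2 <= 1 by rewrite exprn_ile1.
by have := sqr_ge0 (enorm p); lra.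
Qed.

Definition height_expr k : expr R :=
  Subtract (Cst (1 + offset k))
      (Add (Mul (Coord false) (Coord false)) (Mul (Coord true) (Coord true))).

(* The conformal factor [4 / (1 - |p|^2 + offset k)^2]. *)
Definition Gf k : expr R :=
  Mul (Cst 4) (Mul (Mul (Isqrt (height_expr k)) (Isqrt (height_expr k)))
                   (Mul (Isqrt (height_expr k)) (Isqrt (height_expr k)))).

Definition Df k : expr R := Subtract (Gf k.+1) (Gf k).

Lemma ev_height_expr k p : ev (height_expr k) p = height p + offset k.
Proof. by rewrite /= /height edot2; ring. Qed.

Lemma wd_Gf k : wd (Gf k).
Proof.
have w : wd (Isqrt (height_expr k)).
  split; first by rewrite /height_expr /Subtract; cbn [wd]; tauto.
  exists (offset k); first exact: offset_gt0.
  by move=> p /height_bounds /andP[h _]; rewrite ev_height_expr lerDr.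
by split => //; split; split.
Qed.

Lemma wd_Df k : wd (Df k).
Proof. by split; [exact: wd_Gf|split => //; exact: wd_Gf]. Qed.

Lemma ev_Gf k p : disk p -> ev (Gf k) p = factor (height p + offset k).
Proof.
move=> /height_bounds /andP[h _]; rewrite /Gf; cbn [ev]; rewrite ev_height_expr.
have h0 : 0 <= height p + offset k by rewrite addr_ge0// ltW// offset_gt0.
have s2 := sqr_sqrtr h0; rewrite expr2 in s2.
by rewrite -!invfM s2 /factor expr2.
Qed.

Lemma ev_Df k p : disk p -> ev (Df k) p =
  factor (height p + ratio * offset k) - factor (height p + offset k).
Proof. by move=> dp; rewrite /Df /Subtract; cbn [ev]; rewrite !ev_Gf// offsetS mulN1r. Qed.

Lemma positive_Gf k : exists2 c, 0 < c & forall p, disk p -> c <= ev (Gf k) p.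
Proof.
have a0 := @offset_gt0 R k.
exists (factor (1 + offset k)) => [|p dp].
  by rewrite divr_gt0// exprn_gt0// addr_gt0.
have /andP[h0 h1] := height_bounds dp.
rewrite ev_Gf// /factor ler_pM2l// lef_pV2 ?posrE ?exprn_gt0//; [|lra|lra].
by rewrite lerXn2r ?nnegrE//; lra.
Qed.

Lemma positive_Df k : positive_on_disk (Df k).
Proof.
have a0 := @offset_gt0 R k; have [q0 q1] := @ratio_bounds R.
exists (4 * ((offset k - ratio * offset k) * offset k) /
    ((1 + offset k) ^+ 2 * (1 + offset k) ^+ 2)).
  have d0 : 0 < offset k - ratio * offset k by rewrite subr_gt0 gtr_pMl.
  apply: divr_gt0; first by apply: mulr_gt0 => //; exact: mulr_gt0.
  by apply: mulr_gt0; apply: exprn_gt0; apply: addr_gt0.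
by move=> p dp; rewrite ev_Df//; apply: factor_gap_ge => //; exact: height_bounds.
Qed.

Lemma Df_le_Gf k p : disk p -> ev (Df k) p <= ev (Gf k) p / 10 / 10 / 10 / 10.
Proof.
move=> dp; have /andP[h0 _] := height_bounds dp.
by rewrite ev_Df// ev_Gf//; apply: factor_gap_le => //; exact: offset_gt0.
Qed.

Lemma Df_le_next k p : disk p -> ev (Df k) p <= 2 * ev (Df k.+1) p.
Proof.
move=> dp; have /andP[h0 _] := height_bounds dp.
rewrite !ev_Df// offsetS; apply: factor_gap_next => //; exact: offset_gt0.
Qed.

Definition flat : vexpr (R := R) := fun i =>
  if i == 0 then Mul (Cst (2 / (offset0 + 1))) (Coord false)
  else if i == 1 then Mul (Cst (2 / (offset0 + 1))) (Coord true) else Cst 0.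

Lemma vwd_flat : vwd flat.
Proof. by move=> i; rewrite /flat; case: ifP => // _; case: ifP. Qed.

Lemma metric_flat b c p : metric flat b c p = (b == c)%:R * (2 / (offset0 + 1)) ^+ 2.
Proof.
rewrite /metric edot3 /tangent !mxE /=.
by case: b; case: c => /=; rewrite !(mul0r, mulr0, mulr1, mul1r, add0r, addr0) ?expr2.
Qed.

Lemma short_flat : short flat (Gf 0) (Df 0).
Proof.
move=> p dp b c; rewrite metric_flat -mulrBr normrM ev_Df// ev_Gf//.
have := factor_init (height_bounds dp).
have -> : offset 0 = offset0 by rewrite /offset expr0 mulr1.
apply: le_trans; rewrite ler_piMl//.
by case: (b == c); rewrite ?normr1 ?normr0.
Qed.

Definition expansive f (m : R) : Prop := forall p q, disk p -> disk q ->
  m * enorm (q - p) <= enorm (vev f q - vev f p).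

Lemma expansive_flat : expansive flat (2 / (offset0 + 1)).
Proof.
move=> p q _ _; have A0 := @offset0_gt0 R.
have c0 : 0 <= 2 / (@offset0 R + 1) by rewrite divr_ge0// addr_ge0// ltW.
rewrite -(ger0_norm c0) -enormZ /enorm ler_sqrt ?edot_ge0//.
by rewrite edot2 edot3 !mxE /=; set c := 2 / _; lra.
Qed.

(* The bound on e * k.+1 makes the limit injective: all further displacements are
   too small to identify two points at distance 2 / k.+1. *)
Definition admissible k f (e : R) : Prop := [/\ vwd f, short f (Gf k) (Df k), 0 < e,
  e <= rate ^+ (k * k) & exists m, [/\ 0 < m, expansive f m & 8 * e * k.+1%:R <= m]].

Definition refines k f (e : R) f' (e' : R) : Prop := [/\ e' <= e / 2,
  forall p, disk p -> enorm (vev f' p - vev f p) <= e &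
  forall p, disk p -> forall b,
    enorm (tangent f' b p - tangent f b p) <= 13 * Num.sqrt (ev (Df k) p)].

Lemma eps_exists k (m b : R) : 0 < m -> 0 < b ->
  exists e, [/\ 0 < e, e <= rate ^+ (k * k), e <= b & 8 * e * k.+1%:R <= m].
Proof.
move=> m0 b0; have [r0 _] := @rate_bounds R.
have k0 : 0 < 8 * k.+1%:R :> R by rewrite mulr_gt0.
exists (Num.min (rate ^+ (k * k)) (Num.min b (m / (8 * k.+1%:R)))); split.
- by rewrite !lt_min exprn_gt0// b0 divr_gt0.
- by rewrite ge_min lexx.
- by rewrite !ge_min lexx orbT.
- rewrite mulrAC mulrC -ler_pdivlMr//.
  by rewrite !ge_min lexx !orbT.
Qed.

(** Two scales: pairs within rho are expanded by [local_injectivity]; for the others, moving each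
    point by at most m rho / 4 costs at most half of m |q - p|. This is possible because rho is
    known before the frequencies of f' are chosen. *)
Lemma admissible_next k f (e : R) : admissible k f e ->
  exists f' e', admissible k.+1 f' e' /\ refines k f e f' e'.
Proof.
move=> [wf sf e0 _ [m [m0 hm _]]].
have [c c0 hc] := positive_Gf k.
have [rho rho0 hrho] := local_injectivity wf (wd_Gf k) c0 hc (@Df_le_Gf k) sf.
pose eps := Num.min e (m * rho / 4).
have eps0 : 0 < eps by rewrite lt_min e0 divr_gt0// mulr_gt0.
have [f' [wf' h1 h2 h3]] := stage wf (wd_Gf k) (wd_Df k) (positive_Df k) (positive_Df k.+1)
  (@Df_le_Gf k) (@Df_le_next k) sf eps0.
pose m' := Num.min (2 / 5 * Num.sqrt c) (m / 2).
have m'0 : 0 < m' by rewrite lt_min divr_gt0// !mulr_gt0// sqrtr_gt0.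
have hm' : expansive f' m'.
  move=> p q dp dq; have [pq|pq] := leP (enorm (q - p)) rho.
    apply: (le_trans _ (hrho f' wf' h2 p q dp dq pq)).
    by rewrite ler_wpM2r ?enorm_ge0// ge_min lexx.
  have e4 : eps <= m * rho / 4 by rewrite ge_min lexx orbT.
  have k1 : m' * enorm (q - p) <= m / 2 * enorm (q - p).
    by rewrite ler_wpM2r ?enorm_ge0// ge_min lexx orbT.
  have k2 : m * rho <= m * enorm (q - p) by rewrite ler_pM2l// ltW.
  have := hm p q dp dq; have := h1 p dp; have := h1 q dq => g1 g2 g3.
  have -> : vev f' q - vev f' p = (vev f q - vev f p) +
     ((vev f' q - vev f q) - (vev f' p - vev f p)).
    by apply/rowP => i; rewrite !mxE; ring.
  have : enorm (vev f q - vev f p) <= enorm ((vev f q - vev f p) +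
     ((vev f' q - vev f q) - (vev f' p - vev f p))) +
     enorm ((vev f' q - vev f q) - (vev f' p - vev f p)).
    by rewrite -[X in enorm X <= _](addrK ((vev f' q - vev f q) - (vev f' p - vev f p))) enormB.
  have := enormB (vev f' q - vev f q) (vev f' p - vev f p).
  by lra.
have [e' [e'0 e'1 e'2 e'3]] := eps_exists k.+1 m'0 (divr_gt0 e0 (ltr0n _ 2 : 0 < 2)).
exists f', e'; split.
  split => //; last by exists m'.
  move=> p dp b c'; have := h3 p dp b c'.
  rewrite (_ : ev (Add (Gf k) (Df k)) p = ev (Gf k.+1) p)//.
  by rewrite /Df /Subtract; cbn [ev]; ring.
split => // p dp; apply: (le_trans (h1 p dp)); by rewrite ge_min lexx.
Qed.

Lemma admissible_flat : exists e, admissible 0 flat e.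
Proof.
have c0 : 0 < 2 / (@offset0 R + 1) by rewrite divr_gt0// addr_gt0// offset0_gt0.
have [e [e0 e1 _ e3]] := eps_exists 0 c0 ltr01.
exists e; split => //; [exact: vwd_flat|exact: short_flat|].
by exists (2 / (offset0 + 1)); split => //; exact: expansive_flat.
Qed.

(** Dependent choice, in a subtype that carries the admissibility needed for the next step. *)
Lemma approximations : exists (F : nat -> vexpr (R := R)) (e : nat -> R),
  forall k, admissible k (F k) (e k) /\ refines k (F k) (e k) (F k.+1) (e k.+1).
Proof.
pose T k := {s : vexpr (R := R) * R | admissible k s.1 s.2}.
have next k (s : T k) : {s' : T k.+1 |
    refines k (sval s).1 (sval s).2 (sval s').1 (sval s').2}.
  apply: cid; case: s => -[f e] /= /admissible_next [f' [e' [h h']]].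
  by exists (exist _ (f', e') h).
have [e0 h0] := cid admissible_flat.
pose s := fix s k : T k := if k is j.+1 then sval (next j (s j)) else exist _ (flat, e0) h0.
exists (fun k => (sval (s k)).1), (fun k => (sval (s k)).2) => k; split.
  by case: (s k).
by rewrite /=; case: (next k (s k)).
Qed.

End Iteration.

(** * The limit map and its derivative *)

Section TelescopingLimit.
Context {R : realType}.

(** The intervals of centre u k and radius b k are nested, and the supremum of their left ends lies
    in all of them. *)
Lemma telescoping_limit (u b : nat -> R) : (forall k, 0 <= b k) ->
  (forall k, `|u k.+1 - u k| <= b k - b k.+1) ->
  exists l, forall k, `|l - u k| <= b k.
Proof.
move=> b0 hu.
have lo j k : u k - b k <= u (j + k)%N - b (j + k)%N.
  elim: j => // j IH; apply: (le_trans IH).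
  by have := hu (j + k)%N; rewrite ler_norml addSn => /andP[? ?]; lra.
have up j k : u (j + k)%N + b (j + k)%N <= u k + b k.
  elim: j => // j IH; apply: le_trans IH.
  by have := hu (j + k)%N; rewrite ler_norml addSn => /andP[? ?]; lra.
have lu j k : u j - b j <= u k + b k.
  apply: (le_trans (lo k j)); rewrite addnC; apply: le_trans (up j k).
  by have := b0 (j + k)%N; lra.
pose S := range (fun k => u k - b k).
exists (sup S) => k.
have le1 : u k - b k <= sup S.
  apply: ub_le_sup; last by exists k.
  by exists (u 0%N + b 0%N) => _ [j _ <-].
have le2 : sup S <= u k + b k.
  apply: ge_sup; first by exists (u 0%N - b 0%N), 0%N.
  by move=> _ [j _ <-].
by rewrite ler_norml; apply/andP; split; lra.
Qed.

Lemma telescoping_limit_vec (u : nat -> 'rV[R]_3) (b : nat -> R) :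
  (forall k, 0 <= b k) ->
  (forall k, enorm (u k.+1 - u k) <= b k - b k.+1) ->
  exists l, forall k, enorm (l - u k) <= 3 * b k.
Proof.
move=> b0 hu.
have /choice[l hl] (i : 'I_3) : exists l, forall k, `|l - u k 0 i| <= b k.
  apply: telescoping_limit => // k.
  by apply: le_trans (hu k); have := enorm_coord (u k.+1 - u k) i; rewrite !mxE.
exists (\row_i l i) => k; apply: (le_trans (enorm_le_sum _)).
apply: (@le_trans _ _ (\sum_(i < 3) b k)).
  by apply: ler_sum => i _; rewrite !mxE.
by rewrite sumr_const card_ord mulr_natl.
Qed.

Local Notation rate := (@rate R).

Lemma rate_small (C eps : R) : 0 < eps -> exists k, C * rate ^+ k <= eps.
Proof.
move=> eps0; have [r0 r1] := @rate_bounds R.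
have C0 : 0 < `|C| + 1 by rewrite ltr_wpDl.
have /cvg_expr/cvgrPdist_lt : `|rate| < 1 by rewrite gtr0_norm.
move=> /(_ _ (divr_gt0 eps0 C0)) [k _ /(_ k (leqnn k))] /=.
rewrite sub0r normrN gtr0_norm ?exprn_gt0// ltr_pdivlMr// => h.
exists k; apply: (le_trans (ler_norm _)); rewrite normrM (gtr0_norm (exprn_gt0 _ r0)).
by have := exprn_gt0 k r0; rewrite mulrC; lra.
Qed.

(** This is how the estimates below pass to the limit in k. *)
Lemma le0_of_rate (x C : R) : (forall k, x <= C * rate ^+ k) -> x <= 0.
Proof.
move=> h; rewrite leNgt; apply/negP => x0.
have [k hk] := rate_small C (divr_gt0 x0 (ltr0n _ 2 : 0 < 2)).
by have := h k; lra.
Qed.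

End TelescopingLimit.

(** * Uniform convergence on the disk, C^1 convergence in the interior *)

Section Limit.
Context {R : realType}.
Local Notation disk := (@closed_disk R).
Local Notation rate := (@rate R).
Implicit Types (p q : 'rV[R]_2) (k : nat).

Definition step_bound (u : R) : R := Num.sqrt (8 * offset0 / u ^+ 3).

Lemma step_bound_arg_ge0 (u : R) : 0 < u -> 0 <= 8 * offset0 / u ^+ 3.
Proof.
move=> u0; apply: divr_ge0; last exact/exprn_ge0/ltW.
by apply: mulr_ge0 => //; exact/ltW/offset0_gt0.
Qed.

Lemma step_bound_antitone (u v : R) : 0 < u -> u <= v -> step_bound v <= step_bound u.
Proof.
move=> u0 uv; have A0 := @offset0_gt0 R.
have v0 : 0 < v by exact: lt_le_trans uv.
rewrite /step_bound ler_sqrt; last exact: step_bound_arg_ge0.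
rewrite ler_pM2l ?mulr_gt0// lef_pV2 ?posrE ?exprn_gt0// lerXn2r ?nnegrE// ltW//.
Qed.

Lemma offset_rate k : @offset R k = offset0 * rate ^+ k ^+ 2.
Proof. by rewrite /offset ratioE -!exprM mulnC. Qed.

Lemma height_gt0 p : enorm p < 1 -> 0 < height p.
Proof.
by move=> p1; rewrite /height -sqr_enorm subr_gt0 exprn_ilt1 ?enorm_ge0.
Qed.

Lemma factor_decr (u a : R) : 0 < u -> 0 <= a -> factor (u + a) <= factor u.
Proof.
move=> u0 a0; rewrite /factor ler_pM2l// lef_pV2 ?posrE ?exprn_gt0 ?ltr_wpDr//.
by rewrite lerXn2r ?nnegrE ?addr_ge0 ?lerDl// ltW.
Qed.

Lemma limit_gap k p : enorm p < 1 ->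
  factor (height p) - ev (Gf k) p <= (8 * offset0 / height p ^+ 3) * (rate ^+ k) ^+ 2.
Proof.
move=> p1; have u0 := height_gt0 p1.
rewrite ev_Gf; last exact: ltW.
rewrite (le_trans (factor_le_limit u0 (offset_gt0 k)))//.
by rewrite offset_rate le_eqVlt; apply/orP; left; apply/eqP; ring.
Qed.

Lemma Df_le_gap k p : enorm p < 1 ->
  ev (Df k) p <= (8 * offset0 / height p ^+ 3) * (rate ^+ k) ^+ 2.
Proof.
move=> p1; apply: le_trans (limit_gap k p1).
have u0 := height_gt0 p1.
have -> : ev (Df k) p = ev (Gf k.+1) p - ev (Gf k) p.
  by rewrite /Df /Subtract; cbn [ev]; ring.
rewrite lerD2r ev_Gf; last exact: ltW.
by apply: factor_decr => //; rewrite ltW// offset_gt0.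
Qed.

Lemma sqrt_Df_le k p : enorm p < 1 ->
  Num.sqrt (ev (Df k) p) <= step_bound (height p) * rate ^+ k.
Proof.
move=> p1; have [r0 _] := @rate_bounds R.
have x0 := exprn_ge0 k (ltW r0); rewrite -[X in _ <= _ * X](ger0_norm x0).
rewrite -sqrtr_sqr /step_bound -sqrtrM; last exact/step_bound_arg_ge0/height_gt0.
exact/ler_wsqrtr/Df_le_gap.
Qed.

Variables (F : nat -> vexpr (R := R)) (e : nat -> R).
Hypothesis hF : forall k, admissible k (F k) (e k) /\
  refines k (F k) (e k) (F k.+1) (e k.+1).

Let wF k : vwd (F k). Proof. by have [[]] := hF k. Qed.
Let e0 k : 0 < e k. Proof. by have [[]] := hF k. Qed.

Lemma eps_le_rate k : e k <= rate ^+ k.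
Proof.
have [r0 r1] := @rate_bounds R.
have [[_ _ _ h _] _] := hF k; apply: (le_trans h).
by rewrite ler_wiXn2l ?ltW//; case: k {h} => // k; rewrite leq_pmull.
Qed.

Lemma limit_map : exists f : 'rV[R]_2 -> 'rV[R]_3, forall p, disk p ->
  forall k, enorm (f p - vev (F k) p) <= 6 * e k.
Proof.
suff /choice[f hf] : forall p, exists l, disk p ->
    forall k, enorm (l - vev (F k) p) <= 6 * e k by exists f.
move=> p; have [dp|dp] := pselect (disk p); last by exists 0.
(* The e k at least halve at each step, so the displacements from k on add up to at most 2 e k; the
   three coordinates make it 6 e k. *)
have [|k|l hl] := @telescoping_limit_vec R (fun k => vev (F k) p) (fun k => 2 * e k).
- by move=> k; rewrite mulr_ge0// ltW.
- have [_ [h1 h2 _]] := hF k; apply: (le_trans (h2 p dp)).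
  by lra.
by exists l => _ k; rewrite (le_trans (hl k))//; lra.
Qed.

(** 39 = 3 * 13, for three coordinates and the bound 13 sqrt D of a stage; 1 / (1 - rate) sums the
    geometric series, and 1 - r^2 is the least height on the ball of radius r. *)
Definition tangent_tail (r : R) : R := 39 * step_bound (1 - r ^+ 2) / (1 - rate).

Lemma limit_tangent : exists T : bool -> 'rV[R]_2 -> 'rV[R]_3, forall b p r,
  enorm p <= r -> r < 1 -> forall k, enorm (T b p - tangent (F k) b p) <= tangent_tail r * rate ^+ k.
Proof.
have [r0 r1] := @rate_bounds R.
suff /choice[T hT] : forall bp : bool * 'rV[R]_2, exists l, forall r,
    enorm bp.2 <= r -> r < 1 ->
    forall k, enorm (l - tangent (F k) bp.1 bp.2) <= tangent_tail r * rate ^+ k.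
  by exists (fun b p => T (b, p)) => b p; exact: hT (b, p).
move=> [b p] /=; have [p1|p1] := ltP (enorm p) 1; last first.
  by exists 0 => r pr rl; have := lt_le_trans rl (le_trans p1 pr); rewrite ltxx.
have [|k|l hl] := @telescoping_limit_vec R (fun k => tangent (F k) b p)
  (fun k => 13 * step_bound (height p) / (1 - rate) * rate ^+ k).
- move=> k; apply: mulr_ge0; last exact/exprn_ge0/ltW.
  apply: divr_ge0; last by rewrite subr_ge0 ltW.
  by apply: mulr_ge0 => //; exact: sqrtr_ge0.
- have [_ [_ _ h]] := hF k; apply: (le_trans (h p (ltW p1) b)).
  have -> : 13 * step_bound (height p) / (1 - rate) * rate ^+ k -
     13 * step_bound (height p) / (1 - rate) * rate ^+ k.+1 = 13 * (step_bound (height p) * rate ^+ k).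
    by rewrite exprS; field; rewrite subr_eq0 gt_eqF.
  by rewrite ler_pM2l// sqrt_Df_le.
exists l => r pr rl k; apply: (le_trans (hl k)).
rewrite (_ : 3 * _ = 39 * step_bound (height p) / (1 - rate) * rate ^+ k); last first.
  by field; rewrite subr_eq0 gt_eqF.
apply: ler_wpM2r; first exact/exprn_ge0/ltW.
rewrite /tangent_tail; apply: ler_wpM2r; first by rewrite invr_ge0 subr_ge0 ltW.
have rr : 0 <= r by exact: le_trans (enorm_ge0 p) pr.
have : step_bound (height p) <= step_bound (1 - r ^+ 2).
  apply: step_bound_antitone; first by rewrite subr_gt0 exprn_ilt1.
  by rewrite /height -sqr_enorm lerD2l lerN2 lerXn2r ?nnegrE ?enorm_ge0.
have : 0 <= step_bound (height p) by exact: sqrtr_ge0.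
by lra.
Qed.

Lemma tangent_tail_ge0 r : 0 <= r -> r < 1 -> 0 <= tangent_tail r.
Proof.
move=> rr r1; have [_ h] := @rate_bounds R.
apply: divr_ge0; last by rewrite subr_ge0 ltW.
by apply: mulr_ge0; [lra|exact: sqrtr_ge0].
Qed.

Variables (f : 'rV[R]_2 -> 'rV[R]_3) (T : bool -> 'rV[R]_2 -> 'rV[R]_3).
Hypothesis hf : forall p, disk p -> forall k, enorm (f p - vev (F k) p) <= 6 * e k.
Hypothesis hT : forall b p r, enorm p <= r -> r < 1 ->
  forall k, enorm (T b p - tangent (F k) b p) <= tangent_tail r * rate ^+ k.

Lemma edot_limit_tangent b c p : enorm p < 1 ->
  edot (T b p) (T c p) = (b == c)%:R * factor (height p).
Proof.
move=> p1; have [r0 r1] := @rate_bounds R.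
apply/eqP; rewrite -subr_eq0 -normr_le0.
set K := tangent_tail (enorm p); set C := 8 * offset0 / height p ^+ 3.
have K0 : 0 <= K by apply: tangent_tail_ge0; rewrite ?enorm_ge0.
have C0 : 0 <= C by exact/step_bound_arg_ge0/height_gt0.
pose N := enorm (T b p) + enorm (T c p).
(* 2C pays for the defect of f_k and for the part of the metric not yet reached, K (N + K) for
   replacing the limit tangents by those of f_k. *)
apply: (@le0_of_rate _ _ (2 * C + K * (N + K))) => k.
have x0 : 0 <= rate ^+ k by rewrite exprn_ge0// ltW.
have x1 : rate ^+ k <= 1 by rewrite exprn_ile1// ltW.
set x := rate ^+ k in x0 x1 *.
have xx : x ^+ 2 <= x by rewrite expr2 ler_piMl.
have [[_ sk _ _ _] _] := hF k.
have hD : ev (Df k) p <= C * x by rewrite (le_trans (Df_le_gap k p1))// ler_wpM2l.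
have hG : factor (height p) - ev (Gf k) p <= C * x.
  by rewrite (le_trans (limit_gap k p1))// ler_wpM2l.
have hG0 : ev (Gf k) p <= factor (height p).
  rewrite ev_Gf; last exact: ltW.
  by apply: factor_decr; rewrite ?height_gt0// ltW// offset_gt0.
have hs := sk p (ltW p1) b c.
have hG1 : `|(b == c)%:R * (ev (Gf k) p - factor (height p))| <= C * x.
  rewrite normrM (@le_trans _ _ (1 * `|ev (Gf k) p - factor (height p)|))//.
    by rewrite ler_wpM2r//; case: (b == c); rewrite ?normr1 ?normr0.
  by rewrite mul1r ler0_norm ?subr_le0// opprB.
have tb := hT b (lexx (enorm p)) p1 k; have tc := hT c (lexx (enorm p)) p1 k.
rewrite -/K -/x in tb tc.
set db := T b p - _ in tb; set dc := T c p - _ in tc.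
have hm : `|edot (T b p) (T c p) - metric (F k) b c p| <= K * (N + K) * x.
  have -> : edot (T b p) (T c p) - metric (F k) b c p =
      edot (T b p) dc + edot db (T c p) - edot db dc.
    by rewrite /metric /db /dc !edotE; ring.
  have k1 : `|edot (T b p) dc| <= enorm (T b p) * (K * x).
    by rewrite (le_trans (normr_edot _ _))// ler_wpM2l ?enorm_ge0.
  have k2 : `|edot db (T c p)| <= K * x * enorm (T c p).
    by rewrite (le_trans (normr_edot _ _))// ler_wpM2r ?enorm_ge0.
  have k3 : `|edot db dc| <= (K * x) * (K * x).
    by rewrite (le_trans (normr_edot _ _))// ler_pM ?enorm_ge0.
  have k4 : (K * x) * (K * x) <= K * K * x.
    rewrite (_ : (K * x) * (K * x) = K * K * x ^+ 2); last by ring.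
    by apply: ler_wpM2l => //; exact: mulr_ge0.
  rewrite (le_trans (ler_normB _ _))//.
  have := ler_normD (edot (T b p) dc) (edot db (T c p)).
  by rewrite /N; lra.
rewrite [X in `|X| <= _](_ : _ = (edot (T b p) (T c p) - metric (F k) b c p) +
   (metric (F k) b c p - (b == c)%:R * ev (Gf k) p) +
   (b == c)%:R * (ev (Gf k) p - factor (height p))); last by ring.
rewrite (le_trans (ler_normD _ _))//.
have := ler_normD (edot (T b p) (T c p) - metric (F k) b c p)
  (metric (F k) b c p - (b == c)%:R * ev (Gf k) p).
have Cx : 0 <= C * x by exact: mulr_ge0.
by lra.
Qed.

Definition first_order (t0 t1 : 'rV[R]_3) (v : 'rV[R]_2) : 'rV[R]_3 :=
  v 0 0 *: t0 + v 0 1 *: t1.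

Lemma enorm_first_order t0 t1 v B : enorm t0 <= B -> enorm t1 <= B ->
  enorm (first_order t0 t1 v) <= 2 * B * enorm v.
Proof.
move=> h0 h1; rewrite /first_order (le_trans (enormD _ _))// !enormZ.
have B0 : 0 <= B by exact: le_trans (enorm_ge0 _) h0.
have : `|v 0 0| * enorm t0 <= enorm v * B by rewrite ler_pM ?enorm_ge0 ?enorm_coord.
have : `|v 0 1| * enorm t1 <= enorm v * B by rewrite ler_pM ?enorm_ge0 ?enorm_coord.
by lra.
Qed.

Lemma vev_first_order (g : vexpr (R := R)) : vwd g ->
  exists2 L, 0 < L & forall p q, disk p -> disk q ->
   enorm (vev g q - vev g p - first_order (tangent g false p) (tangent g true p) (q - p))
     <= L * enorm (q - p) ^+ 2.
Proof.
move=> wg; have [K0 K00 hK0] := vev_lipschitz (vwd_pd false wg).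
have [K1 K10 hK1] := vev_lipschitz (vwd_pd true wg).
exists (2 * (K0 + K1)) => [|p q dp dq]; first by rewrite mulr_gt0// addr_gt0.
set v := q - p; set w := _ - _ - first_order _ _ _.
have [w0|w0] := eqVneq (enorm w) 0.
  by rewrite w0 mulr_ge0 ?sqr_ge0// mulr_ge0// ltW// addr_gt0.
have wp : 0 < enorm w by rewrite lt_def w0 enorm_ge0.
(* The remainder w is its own test vector. *)
have [z [dz _ zp h]] := vev_mvt w wg dp dq; rewrite -/v in zp h.
rewrite -(ler_pM2l wp) -expr2 (sqr_enorm w) {2}/w edotDr edotNr h -edotNr -edotDr.
rewrite (le_trans (edot_le_enorm _ _))// ler_pM2l//.
have -> : v 0 0 *: tangent g false z + v 0 1 *: tangent g true z -
   first_order (tangent g false p) (tangent g true p) v =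
   first_order (tangent g false z - tangent g false p) (tangent g true z - tangent g true p) v.
  by rewrite /first_order !scalerBr opprD addrACA.
have n0 := enorm_ge0 v.
have m0 : K0 * enorm (z - p) <= K0 * enorm v by rewrite ler_pM2l.
have m1 : K1 * enorm (z - p) <= K1 * enorm v by rewrite ler_pM2l.
have p0 : 0 <= K0 * enorm v by rewrite mulr_ge0// ltW.
have p1 : 0 <= K1 * enorm v by rewrite mulr_ge0// ltW.
rewrite (@le_trans _ _ (2 * ((K0 + K1) * enorm v) * enorm v))//; last first.
  by rewrite le_eqVlt expr2; apply/orP; left; apply/eqP; ring.
apply: enorm_first_order.
  by have := hK0 p z dp dz; rewrite /tangent; lra.
by have := hK1 p z dp dz; rewrite /tangent; lra.
Qed.

(** T is not yet known to be the derivative of f, so the mean value estimate is applied to f_j -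
    f_k, and j tends to infinity. *)
Lemma limit_increment k p q r : enorm p <= r -> enorm q <= r -> r < 1 ->
  enorm ((f q - vev (F k) q) - (f p - vev (F k) p)) <= 4 * tangent_tail r * rate ^+ k * enorm (q - p).
Proof.
move=> pr qr r1; have [s0 s1] := @rate_bounds R.
have r0 : 0 <= r by exact: le_trans (enorm_ge0 p) pr.
have dp : disk p by exact: le_trans pr (ltW r1).
have dq : disk q by exact: le_trans qr (ltW r1).
have t0 := tangent_tail_ge0 r0 r1.
rewrite -subr_le0; apply: (@le0_of_rate _ _ (12 + 4 * tangent_tail r * enorm (q - p))) => j.
have hmean : enorm (vev (vsub (F j) (F k)) q - vev (vsub (F j) (F k)) p) <=
     2 * (tangent_tail r * rate ^+ k + tangent_tail r * rate ^+ j) * enorm (q - p).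
  apply: (@vev_mean_le R _ _ r) => //; first exact: vwd_sub.
  move=> z b dz zr; rewrite tangent_sub.
  have -> : tangent (F j) b z - tangent (F k) b z =
    (T b z - tangent (F k) b z) - (T b z - tangent (F j) b z).
    by apply/rowP => i; rewrite !mxE; ring.
  by rewrite (le_trans (enormB _ _))// lerD// hT.
have hq : enorm (f q - vev (F j) q) <= 6 * rate ^+ j.
  by rewrite (le_trans (hf dq j))// ler_pM2l// eps_le_rate.
have hp : enorm (f p - vev (F j) p) <= 6 * rate ^+ j.
  by rewrite (le_trans (hf dp j))// ler_pM2l// eps_le_rate.
have -> : (f q - vev (F k) q) - (f p - vev (F k) p) =
  ((f q - vev (F j) q) - (f p - vev (F j) p)) +
  (vev (vsub (F j) (F k)) q - vev (vsub (F j) (F k)) p).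
  by rewrite !vev_sub; apply/rowP => i; rewrite !mxE; ring.
have := enormD ((f q - vev (F j) q) - (f p - vev (F j) p))
  (vev (vsub (F j) (F k)) q - vev (vsub (F j) (F k)) p).
have := enormB (f q - vev (F j) q) (f p - vev (F j) p).
have : 0 <= tangent_tail r * enorm (q - p) * rate ^+ k.
  by apply: mulr_ge0; [apply: mulr_ge0 => //; exact: enorm_ge0|exact/exprn_ge0/ltW].
have : 0 <= tangent_tail r * enorm (q - p) * rate ^+ j.
  by apply: mulr_ge0; [apply: mulr_ge0 => //; exact: enorm_ge0|exact/exprn_ge0/ltW].
by lra.
Qed.

Lemma limit_first_order p eps : enorm p < 1 -> 0 < eps ->
  exists2 d, 0 < d & forall q, enorm (q - p) <= d ->
    enorm q < 1 /\
    enorm (f q - f p - first_order (T false p) (T true p) (q - p)) <= eps * enorm (q - p).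
Proof.
move=> p1 eps0; have [s0 s1] := @rate_bounds R.
pose r := (1 + enorm p) / 2.
have pr : enorm p <= r by rewrite /r; lra.
have r1 : r < 1 by rewrite /r; lra.
have r0 : 0 <= r by exact: le_trans (enorm_ge0 p) pr.
(* 6 = 4 + 2: the increment of f - f_k, and the replacement of T by the tangents of f_k. *)
have [k hk] := @rate_small R (6 * tangent_tail r) (eps / 2) (divr_gt0 eps0 (ltr0n _ 2 : 0 < 2)).
have [L L0 hL] := vev_first_order (wF k).
pose d := Num.min ((1 - enorm p) / 2) (eps / 2 / L).
have d0 : 0 < d by rewrite lt_min !divr_gt0// subr_gt0.
exists d => // q qd.
have qr : enorm q <= r.
  have := enormD (q - p) p; rewrite subrK.
  have : d <= (1 - enorm p) / 2 by rewrite ge_min lexx.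
  by rewrite /r; lra.
have dp : disk p by exact: ltW.
have dq : disk q by exact: le_trans qr (ltW r1).
split; first exact: le_lt_trans qr r1.
set v := q - p in qd *.
have h1 := limit_increment k pr qr r1; rewrite -/v in h1.
have h2 := hL p q dp dq; rewrite -/v in h2.
have h3 : enorm (first_order (T false p - tangent (F k) false p) (T true p - tangent (F k) true p) v)
    <= 2 * (tangent_tail r * rate ^+ k) * enorm v by apply: enorm_first_order; exact: hT.
have h4 : L * enorm v ^+ 2 <= eps / 2 * enorm v.
  rewrite expr2 mulrA ler_wpM2r ?enorm_ge0// mulrC -ler_pdivlMr//.
  by rewrite (le_trans qd)// ge_min lexx orbT.
have h5 : 6 * tangent_tail r * rate ^+ k * enorm v <= eps / 2 * enorm v.
  by rewrite ler_wpM2r ?enorm_ge0.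
have -> : f q - f p - first_order (T false p) (T true p) v =
  ((f q - vev (F k) q) - (f p - vev (F k) p)) +
  (vev (F k) q - vev (F k) p - first_order (tangent (F k) false p) (tangent (F k) true p) v) -
  first_order (T false p - tangent (F k) false p) (T true p - tangent (F k) true p) v.
  by apply/rowP => i; rewrite !mxE; ring.
rewrite (le_trans (enormB _ _))//.
have := enormD ((f q - vev (F k) q) - (f p - vev (F k) p))
  (vev (F k) q - vev (F k) p - first_order (tangent (F k) false p) (tangent (F k) true p) v).
by lra.
Qed.

Lemma limit_tangent_continuous b p eps : enorm p < 1 -> 0 < eps ->
  exists2 d, 0 < d & forall q, enorm (q - p) <= d -> enorm (T b q - T b p) <= eps.
Proof.
move=> p1 eps0; have [s0 s1] := @rate_bounds R.
pose r := (1 + enorm p) / 2.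
have pr : enorm p <= r by rewrite /r; lra.
have r1 : r < 1 by rewrite /r; lra.
have [k hk] := @rate_small R (2 * tangent_tail r) (eps / 2) (divr_gt0 eps0 (ltr0n _ 2 : 0 < 2)).
have [L L0 hL] := vev_lipschitz (vwd_pd b (wF k)).
pose d := Num.min ((1 - enorm p) / 2) (eps / 2 / L).
have d0 : 0 < d by rewrite lt_min !divr_gt0// subr_gt0.
exists d => // q qd.
have qr : enorm q <= r.
  have := enormD (q - p) p; rewrite subrK.
  have : d <= (1 - enorm p) / 2 by rewrite ge_min lexx.
  by rewrite /r; lra.
have h1 := hT b pr r1 k; have h2 := hT b qr r1 k.
have h3 := hL p q (ltW p1) (le_trans qr (ltW r1)).
have h4 : L * enorm (q - p) <= eps / 2.
  by rewrite mulrC -ler_pdivlMr// (le_trans qd)// ge_min lexx orbT.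
have -> : T b q - T b p = (T b q - tangent (F k) b q) - (T b p - tangent (F k) b p) +
    (tangent (F k) b q - tangent (F k) b p).
  by apply/rowP => i; rewrite !mxE; ring.
rewrite (le_trans (enormD _ _))//.
have := enormB (T b q - tangent (F k) b q) (T b p - tangent (F k) b p).
by rewrite /tangent in h1 h2 h3 *; lra.
Qed.

End Limit.

(** * Topology and differential in terms of the Euclidean norm *)

Section EuclideanTopology.
Context {R : realType}.

Lemma nbhs_enorm n (p : 'rV[R]_n) (A : set 'rV[R]_n) :
  (exists2 d, 0 < d & forall q, enorm (q - p) <= d -> A q) <-> nbhs p A.
Proof.
have n0 : 0 < n%:R + 1 :> R by rewrite ltr_wpDl.
split=> [[d d0 hd]|/(nbhs_normP p A)[d /= d0 hd]].
  apply/(nbhs_normP p A); exists (d / (n%:R + 1)); first by rewrite /= divr_gt0.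
  move=> q /= pq; apply: hd; rewrite enormBC (le_trans (enorm_le_mx_norm _))//.
  rewrite ltr_pdivlMr// mulrDr mulr1 in pq.
  by rewrite mulrC (le_trans _ (ltW pq))// lerDl.
exists (d / 2); first by rewrite divr_gt0.
move=> q pq; apply: hd => /=; rewrite -opprB normrN.
apply: (le_lt_trans (mx_norm_le_enorm _)); apply: (le_lt_trans pq).
by rewrite ltr_pdivrMr// ltr_pMr// ltr1n.
Qed.

Lemma cvg_enormP (T : Type) (F : set_system T) (FF : Filter F) n (f : T -> 'rV[R]_n) (l : 'rV[R]_n) :
  f @ F --> l <-> forall eps : R, 0 < eps -> \forall x \near F, enorm (f x - l) <= eps.
Proof.
split=> [fl eps eps0|h A /nbhs_enorm[d d0 hd]].
  by apply: (fl [set y | enorm (y - l) <= eps]); apply/nbhs_enorm; exists eps.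
by apply: filterS (h d d0) => x; exact: hd.
Qed.

Lemma continuous_enorm n m (f : 'rV[R]_n -> 'rV[R]_m) p :
  (forall eps : R, 0 < eps -> exists2 d, 0 < d &
     forall q, enorm (q - p) <= d -> enorm (f q - f p) <= eps) ->
  {for p, continuous f}.
Proof.
move=> h A /nbhs_enorm[d d0 hd]; have [c c0 hc] := h d d0.
by apply/(@nbhs_enorm n p (f @^-1` A)); exists c => // q /hc /hd.
Qed.

Lemma diff_enorm n m (f : 'rV[R]_n -> 'rV[R]_m) p (M : 'M[R]_(n, m)) (C : R) :
  (forall v, enorm (v *m M) <= C * enorm v) ->
  (forall eps : R, 0 < eps -> exists2 d, 0 < d & forall q, enorm (q - p) <= d ->
     enorm (f q - f p - (q - p) *m M) <= eps * enorm (q - p)) ->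
  differentiable f p /\ 'd f p = mulmxr M :> ('rV[R]_n -> 'rV[R]_m).
Proof.
move=> hM h.
have C0 : 0 < `|C| + 1 by rewrite ltr_wpDl.
have cM : continuous (mulmxr M : 'rV[R]_n -> 'rV[R]_m).
  move=> v; apply: continuous_enorm => eps eps0.
  exists (eps / (`|C| + 1)); first by rewrite divr_gt0.
  move=> q vq; rewrite /= -mulmxBl (le_trans (hM _))//.
  rewrite ler_pdivlMr// in vq; apply: le_trans vq; rewrite mulrC ler_wpM2l ?enorm_ge0//.
  by have := ler_norm C; lra.
have E : f \o shift p = cst (f p) + (mulmxr M : 'rV[R]_n -> 'rV[R]_m) +o_ (0 : 'rV[R]_n) id.
  apply/eqaddoP => eps eps0.
  have n0 : 0 < n%:R + 1 :> R by rewrite ltr_wpDl.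
  have [d d0 hd] := h _ (divr_gt0 eps0 n0).
  apply/nbhs_enorm; exists d => // v; rewrite subr0 => vd.
  have -> : (f \o shift p - (cst (f p) + mulmxr M)) v = f (v + p) - f p - v *m M.
    by rewrite !fctE /= opprD addrA.
  have := hd (v + p); rewrite addrK => /(_ vd) h1.
  apply: (le_trans (mx_norm_le_enorm _)); apply: (le_trans h1).
  rewrite mulrAC ler_pdivrMr// -mulrA ler_pM2l//.
  apply: (le_trans (enorm_le_mx_norm _)); rewrite mulrC ler_wpM2l//.
  by rewrite lerDl.
have dE := diff_unique cM E.
by split => //; apply/diff_locallyP; rewrite dE.
Qed.

Lemma open_diskE (p : 'rV[R]_2) : open_disk p <-> enorm p < 1.
Proof.
split=> [/nbhs_enorm[d d0 hd]|p1]; last first.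
  apply/nbhs_enorm; exists (1 - enorm p); first by rewrite subr_gt0.
  move=> q qp; rewrite /closed_disk /=.
  by have := enormD (q - p) p; rewrite subrK; lra.
have p1 : enorm p <= 1 by apply: hd; rewrite subrr enorm0 ltW.
rewrite lt_neqAle p1 andbT; apply/eqP => pE.
(* A unit vector p is not interior: (1 + d) p lies outside the disk, at distance d from p. *)
have : enorm ((1 + d) *: p) <= 1.
  by apply: hd; rewrite scalerDl scale1r [p + _]addrC addrK enormZ pE mulr1 gtr0_norm.
by rewrite enormZ pE mulr1 gtr0_norm ?addr_gt0//; lra.
Qed.

End EuclideanTopology.

(** * Regularity of the limit map *)

Section LimitMapRegularity.
Context {R : realType}.
Local Notation disk := (@closed_disk R).
Local Notation rate := (@rate R).
Implicit Types (p q v w : 'rV[R]_2) (k : nat).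

Variables (F : nat -> vexpr (R := R)) (e : nat -> R).
Hypothesis hF : forall k, admissible k (F k) (e k) /\
  refines k (F k) (e k) (F k.+1) (e k.+1).
Variables (f : 'rV[R]_2 -> 'rV[R]_3) (T : bool -> 'rV[R]_2 -> 'rV[R]_3).
Hypothesis hf : forall p, disk p -> forall k, enorm (f p - vev (F k) p) <= 6 * e k.
Hypothesis hT : forall b p r, enorm p <= r -> r < 1 ->
  forall k, enorm (T b p - tangent (F k) b p) <= tangent_tail r * rate ^+ k.

Definition tangent_mx p : 'M[R]_(2, 3) := \matrix_(i, j) T (i == 1) p 0 j.

Lemma mulmx_tangent_mx p v : v *m tangent_mx p = first_order (T false p) (T true p) v.
Proof.
apply/rowP => j; rewrite /first_order !mxE !big_ord_recl big_ord0 addr0 !mxE.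
by congr (v 0 _ * T _ p 0 j + v 0 _ * T _ p 0 j); apply/val_inj.
Qed.

Lemma limit_diff p : enorm p < 1 ->
  differentiable f p /\ 'd f p = mulmxr (tangent_mx p) :> ('rV[R]_2 -> 'rV[R]_3).
Proof.
move=> p1; pose B := enorm (T false p) + enorm (T true p).
apply: (@diff_enorm _ _ _ f p (tangent_mx p) (2 * B)).
  move=> v; rewrite mulmx_tangent_mx; apply: enorm_first_order.
    by rewrite lerDl enorm_ge0.
  by rewrite lerDr enorm_ge0.
move=> eps eps0; have [d d0 hd] := limit_first_order hF hf hT p1 eps0.
by exists d => // q /hd[_]; rewrite mulmx_tangent_mx.
Qed.

Lemma limit_jacobian p : enorm p < 1 -> jacobian f p = tangent_mx p.
Proof.
move=> /limit_diff[_ dE]; apply/matrixP => i j.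
by rewrite /jacobian mxE dE /= -rowE mxE.
Qed.

Lemma limit_C1 : C1_on (@open_disk R) f.
Proof.
move=> p /open_diskE p1; split; first exact: (limit_diff p1).1.
move=> A /(nbhs_normP (jacobian f p) A)[d /= d0 hd].
have d2 : 0 < d / 2 by rewrite divr_gt0.
have [c0 c00 hc0] := limit_tangent_continuous hF hT false p1 d2.
have [c1 c10 hc1] := limit_tangent_continuous hF hT true p1 d2.
apply/(@nbhs_enorm _ _ p (jacobian f @^-1` A)).
exists (Num.min (Num.min c0 c1) ((1 - enorm p) / 2)).
  by rewrite !lt_min c00 c10 divr_gt0// subr_gt0.
move=> q; rewrite !le_min => /andP[/andP[q0 q1] qp]; apply: hd => /=.
have q_lt : enorm q < 1.
  by have := enormD (q - p) p; rewrite subrK; lra.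
rewrite !limit_jacobian// (@le_lt_trans _ _ (d / 2))//; last first.
  by rewrite ltr_pdivrMr// ltr_pMr// ltr1n.
rewrite -opprB normrN [`|_|]mx_normrE bigmax_le ?ltW// => -[i j] _ /=.
rewrite !mxE; have := hc0 q q0; have := hc1 q q1 => h1 h0.
case: (i == 1).
  by apply: le_trans h1; have := enorm_coord (T true q - T true p) j; rewrite !mxE.
by apply: le_trans h0; have := enorm_coord (T false q - T false p) j; rewrite !mxE.
Qed.

Lemma limit_isometric : hyperbolic_isometric f.
Proof.
move=> p /open_diskE p1 v w; rewrite (limit_diff p1).2 /= !mulmx_tangent_mx.
rewrite /first_order !edotE !(edot_limit_tangent hF hT _ _ p1) /=.
by rewrite /hyperbolic_metric edot2 /factor /height; ring.
Qed.

Lemma limit_immersion : immersion_on (@open_disk R) f.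
Proof.
move=> p op v w vw; have /open_diskE p1 := op.
have : edot ('d f p (v - w)) ('d f p (v - w)) = 0.
  by rewrite linearB /= vw subrr edot0l.
rewrite limit_isometric// /hyperbolic_metric => /eqP.
have u0 := height_gt0 p1; rewrite /height in u0.
rewrite mulf_eq0 invr_eq0 expf_eq0 /= (gt_eqF u0) orbF mulf_eq0 pnatr_eq0 /=.
rewrite -sqr_enorm expf_eq0 /= => /eqP /enorm_eq0 /eqP.
by rewrite subr_eq0 => /eqP.
Qed.

Lemma limit_injective p q : disk p -> disk q -> f p = f q -> p = q.
Proof.
move=> dp dq fpq; apply/eqP; rewrite eq_sym -subr_eq0; apply/eqP/enorm_eq0/eqP.
rewrite eq_le enorm_ge0 andbT leNgt; apply/negP => d0.
(* At this n, expansion puts the images under f_n at least 16 e_n apart, while f p = f q leaves at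
   most 2 * 6 e_n. *)
have [n hn] : exists n : nat, 2 / enorm (q - p) <= n%:R.
  by exists (Num.bound (2 / enorm (q - p))); rewrite ltW// archi_boundP// divr_ge0// enorm_ge0.
have [[_ _ en _ [m [m0 hm hem]]] _] := hF n.
have h1 := hm p q dp dq; have h2 := hf dp n; have h3 := hf dq n.
have h4 : enorm (vev (F n) q - vev (F n) p) <= 12 * e n.
  have -> : vev (F n) q - vev (F n) p = (f p - vev (F n) p) - (f q - vev (F n) q).
    by rewrite fpq; apply/rowP => i; rewrite !mxE; ring.
  by rewrite (le_trans (enormB _ _))//; lra.
have n1 : 2 <= n.+1%:R * enorm (q - p).
  rewrite ler_pdivrMr// in hn; rewrite (le_trans hn)// ler_wpM2r ?enorm_ge0// ler_nat.
  exact: leqnSn.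
have h5 : 8 * e n * n.+1%:R * enorm (q - p) <= m * enorm (q - p).
  by rewrite ler_wpM2r ?enorm_ge0.
have h6 : 8 * e n * 2 <= 8 * e n * (n.+1%:R * enorm (q - p)).
  by rewrite ler_wpM2l// mulr_ge0// ltW.
by clear fpq; lra.
Qed.

Lemma limit_uniformly_continuous eps : 0 < eps -> exists2 d, 0 < d &
  forall p q, disk p -> disk q -> enorm (q - p) <= d -> enorm (f q - f p) <= eps.
Proof.
move=> eps0; have [k hk] := @rate_small R 12 (eps / 2) (divr_gt0 eps0 (ltr0n _ 2 : 0 < 2)).
have [[wF _ _ _ _] _] := hF k.
have [L L0 hL] := vev_lipschitz wF.
exists (eps / 2 / L) => [|p q dp dq]; first by rewrite !divr_gt0.
rewrite ler_pdivlMr// => hd.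
have h1 := hL p q dp dq; have h2 := hf dp k; have h3 := hf dq k.
have h4 := eps_le_rate hF k.
have -> : f q - f p = (f q - vev (F k) q) - (f p - vev (F k) p) + (vev (F k) q - vev (F k) p).
  by apply/rowP => i; rewrite !mxE; ring.
rewrite (le_trans (enormD _ _))//.
have := enormB (f q - vev (F k) q) (f p - vev (F k) p).
by lra.
Qed.

(** Only height >= 0 is used, so the bound holds up to the boundary, at the price of growing like
    rate^(-2k). *)
Lemma sqrt_Df_global k p : disk p -> Num.sqrt (ev (Df k) p) <= (offset k)^-1.
Proof.
move=> dp; have a0 := @offset_gt0 R k.
have i0 : 0 <= (@offset R k)^-1 by rewrite invr_ge0 ltW.
rewrite -(ger0_norm i0) -sqrtr_sqr; apply: ler_wsqrtr.
apply: (le_trans (Df_le_Gf k dp)); rewrite ev_Gf//.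
have /andP[h0 _] := height_bounds dp.
have z0 : 0 < height p + offset k by rewrite ltr_wpDl.
have : factor (height p + offset k) <= 4 * (offset k)^-1 ^+ 2.
  rewrite /factor exprVn ler_pM2l// lef_pV2 ?posrE ?exprn_gt0//.
  by rewrite lerXn2r ?nnegrE ?lerDr// ltW.
have : 0 <= (@offset R k)^-1 ^+ 2 by exact: sqr_ge0.
by lra.
Qed.

Lemma increment_le k p q : disk p -> disk q ->
  let D := enorm ((vev (F k.+1) q - vev (F k) q) - (vev (F k.+1) p - vev (F k) p)) in
  D <= 2 * rate ^+ k ^+ k /\ D <= 26 / offset0 / (rate ^+ k) ^+ 2 * enorm (q - p).
Proof.
move=> dp dq D.
have [[wk _ _ ek _] [_ h1 h2]] := hF k.
have [[wk' _ _ _ _] _] := hF k.+1.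
split.
  rewrite /D (le_trans (enormB _ _))// -exprM.
  by have := h1 p dp; have := h1 q dq; lra.
have -> : 26 / offset0 / (rate ^+ k) ^+ 2 = 2 * (13 * (@offset R k)^-1).
  by rewrite offset_rate (invfM offset0); move: offset0^-1 (rate ^+ k ^+ 2)^-1 => y z; ring.
rewrite /D -!vev_sub; apply: (@vev_mean_le R _ _ 1) => //.
move=> z b dz _; rewrite tangent_sub (le_trans (h2 z dz b))// ler_pM2l//.
exact: sqrt_Df_global.
Qed.

(* Interpolation between the C^0 bound [2 x^k] and the Lipschitz bound [C / x^2],
   x = rate^k: the superexponential decay of the first one wins for every b < 1. *)
Lemma interpolation (C b : R) : 0 < C -> 0 < b < 1 -> exists2 K, 0 < K &
  forall k (D d : R), 0 < d -> d <= 2 -> D <= 2 * rate ^+ k ^+ k ->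
    D <= C / (rate ^+ k) ^+ 2 * d -> D <= K * rate ^+ k * d `^ b.
Proof.
move=> C0 /andP[b0 b1]; have [s0 s1] := @rate_bounds R.
(* For d < x^N this gives d^(1 - b) <= x^3: two powers absorb x^-2, the third makes the bounds
   summable in k. *)
have [N hN] : exists N : nat, 3 <= N%:R * (1 - b).
  exists (Num.bound (3 / (1 - b))); rewrite -ler_pdivrMr ?subr_gt0//.
  by rewrite ltW// archi_boundP// divr_ge0// subr_ge0 ltW.
pose K := 2 + C + 2 * C / (rate ^+ N) ^+ 3.
have sN : 0 < rate ^+ N by rewrite exprn_gt0.
have K0 : 0 <= 2 * C / (rate ^+ N) ^+ 3 by rewrite divr_ge0 ?mulr_ge0 ?exprn_ge0// ltW.
exists K => [|k D d d0 d2]; first by rewrite /K; lra.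
set x := rate ^+ k => D1 D2.
have x0 : 0 < x by rewrite exprn_gt0.
have x1 : x <= 1 by rewrite exprn_ile1// ltW.
have db0 : 0 < d `^ b by rewrite powR_gt0.
have dE : d = d `^ (1 - b) * d `^ b.
  by rewrite -powRD ?subrK ?powRr1 ?ltW// gt_eqF ?implybT.
have d21 : d `^ (1 - b) <= 2.
  have h : 2 `^ (1 - b) <= 2 :> R by apply: ler1_powR; lra.
  by apply: le_trans h; apply: ge0_ler_powR; rewrite ?nnegrE//; lra.
have xdb : 0 <= x * d `^ b by rewrite mulr_ge0 ?ltW.
(* Finitely many k: the Lipschitz bound suffices, with a constant depending on N. *)
have [kN|Nk] := leqP k N.
  apply: (le_trans D2).
  have h1 : rate ^+ N <= x by rewrite /x ler_wiXn2l ?ltW.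
  have h2 : C / x ^+ 2 * d <= (2 * C / (rate ^+ N) ^+ 3) * (x * d `^ b).
    rewrite {1}dE (_ : C / x ^+ 2 * (d `^ (1 - b) * d `^ b) =
       (d `^ (1 - b) * C / x ^+ 3) * (x * d `^ b)); last by field; rewrite gt_eqF.
    apply: ler_wpM2r => //; apply: ler_pM.
    - by rewrite mulr_ge0 ?powR_ge0// ltW.
    - by rewrite invr_ge0 exprn_ge0// ltW.
    - by rewrite ler_pM2r.
    - by rewrite lef_pV2 ?posrE ?exprn_gt0// lerXn2r ?nnegrE// ltW.
  by apply: (le_trans h2); rewrite -(mulrA K); apply: ler_wpM2r => //; rewrite /K; lra.
(* For d >= x^N the C^0 bound wins, as x^k <= x * x^N <= x * d^b. *)
have [dx|xd] := ltP d (x ^+ N); last first.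
  apply: (le_trans D1).
  have h1 : x ^+ N <= d `^ b.
    have xN0 : 0 < x ^+ N by rewrite exprn_gt0.
    apply: (@le_trans _ _ ((x ^+ N) `^ b)).
      by apply: ger1_powR; [rewrite xN0 exprn_ile1// ltW|exact: ltW].
    by apply: ge0_ler_powR; rewrite ?nnegrE//; exact: ltW.
  have h2 : x ^+ k <= x * x ^+ N by rewrite -exprS ler_wiXn2l// ltW.
  have h3 : x * x ^+ N <= x * d `^ b by rewrite ler_pM2l.
  have h4 : 2 * (x * d `^ b) <= K * (x * d `^ b) by rewrite ler_wpM2r// /K; lra.
  by lra.
apply: (le_trans D2).
have h1 : d `^ (1 - b) <= x ^+ 3.
  apply: (@le_trans _ _ ((x ^+ N) `^ (1 - b))).
    by apply: ge0_ler_powR; rewrite ?nnegrE ?subr_ge0 ltW// exprn_gt0.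
  rewrite -(powR_mulrn N (ltW x0)) -powRrM -(powR_mulrn 3 (ltW x0)).
  have hx : 0 < x <= 1 by rewrite x0.
  exact: (ger_powR hx hN).
have h2 : C / x ^+ 2 * d <= C * (x * d `^ b).
  rewrite {1}dE (_ : C / x ^+ 2 * (d `^ (1 - b) * d `^ b) =
    C * ((d `^ (1 - b) / x ^+ 2) * d `^ b)); last by field; rewrite gt_eqF.
  by rewrite ler_pM2l// ler_pM2r// ler_pdivrMr ?exprn_gt0.
by apply: (le_trans h2); rewrite -(mulrA K); apply: ler_wpM2r => //; rewrite /K; lra.
Qed.

Lemma limit_holder b : 0 < b < 1 -> holder_on disk b f.
Proof.
move=> b01; have [s0 s1] := @rate_bounds R; have /andP[b0 b1] := b01.
have C0 : 0 < 26 / @offset0 R by rewrite divr_gt0// offset0_gt0.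
have [K K0 hK] := interpolation C0 b01.
have [[wF0 _ _ _ _] _] := hF 0.
have [L L0 hL] := vev_lipschitz wF0.
pose C := 2 * L + K / (1 - rate).
exists C => p q dp dq; rewrite /edist enormBC (enormBC p q).
have KR : 0 < K / (1 - rate) by rewrite divr_gt0// subr_gt0.
have C00 : 0 <= C by rewrite /C; lra.
have [d0|d0] := eqVneq (enorm (q - p)) 0.
  have := enorm_eq0 d0 => /eqP; rewrite subr_eq0 => /eqP ->.
  by rewrite subrr enorm0 mulr_ge0// powR_ge0.
have dp0 : 0 < enorm (q - p) by rewrite lt_def d0 enorm_ge0.
have d2 : enorm (q - p) <= 2.
  rewrite (le_trans (enormB _ _))//.
  by have := dp; have := dq; rewrite /closed_disk /=; lra.
set d := enorm (q - p) in d0 dp0 d2 *.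
have dd : d <= 2 * d `^ b.
  have h : d `^ (1 - b) <= 2.
    have h2 : 2 `^ (1 - b) <= 2 :> R by apply: ler1_powR; lra.
    by apply: le_trans h2; apply: ge0_ler_powR; rewrite ?nnegrE//; lra.
  have {1}-> : d = d `^ (1 - b) * d `^ b.
    by rewrite -powRD ?subrK ?powRr1 ?ltW// gt_eqF ?implybT.
  by rewrite ler_wpM2r// powR_ge0.
have partial n : enorm (vev (F n) q - vev (F n) p) <=
    (2 * L + K / (1 - rate) * (1 - rate ^+ n)) * d `^ b.
  elim: n => [|n IH].
    rewrite expr0 subrr mulr0 addr0 (le_trans (hL p q dp dq))// mulrAC mulrC -mulrA mulrC.
    by rewrite -/d [leRHS](_ : _ = L * (2 * d `^ b)) ?ler_pM2l//; ring.
  have [h1 h2] := increment_le n dp dq.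
  have h3 := hK n _ d dp0 d2 h1 h2.
  have -> : vev (F n.+1) q - vev (F n.+1) p = (vev (F n) q - vev (F n) p) +
    ((vev (F n.+1) q - vev (F n) q) - (vev (F n.+1) p - vev (F n) p)).
    by apply/rowP => i; rewrite !mxE; ring.
  rewrite (le_trans (enormD _ _))// (le_trans (lerD IH h3))//.
  rewrite le_eqVlt; apply/orP; left; apply/eqP; rewrite exprS.
  by field; rewrite subr_eq0 gt_eqF.
rewrite -subr_le0; apply: (@le0_of_rate _ _ 12) => n.
have h1 := partial n; have h2 := hf dp n; have h3 := hf dq n.
have h4 := eps_le_rate hF n.
have h5 : (2 * L + K / (1 - rate) * (1 - rate ^+ n)) * d `^ b <= C * d `^ b.
  rewrite ler_wpM2r ?powR_ge0// /C lerD2l ler_piMr ?(ltW KR)//.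
  by rewrite gerBl exprn_ge0// ltW.
have -> : f q - f p = (f q - vev (F n) q) - (f p - vev (F n) p) + (vev (F n) q - vev (F n) p).
  by apply/rowP => i; rewrite !mxE; ring.
have := enormD ((f q - vev (F n) q) - (f p - vev (F n) p)) (vev (F n) q - vev (F n) p).
have := enormB (f q - vev (F n) q) (f p - vev (F n) p).
by lra.
Qed.

End LimitMapRegularity.

(** * Topology of the disk *)

Section DiskTopology.
Context {R : realType}.
Local Notation disk := (@closed_disk R).
Local Notation X := (hyperbolic_plane R).

Definition unit_circle : set 'rV[R]_2 := [set p | enorm p = 1].

Lemma closed_enorm_le n (r : R) : closed [set p : 'rV[R]_n | enorm p <= r].
Proof.
rewrite -openC openE => p /= /negP; rewrite -ltNge => rp.
apply/nbhs_enorm; exists ((enorm p - r) / 2); first by rewrite divr_gt0// subr_gt0.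
move=> q qp /= qr; have := enormD (p - q) q; rewrite subrK enormBC.
by lra.
Qed.

Lemma compact_enorm_le n (r : R) : compact [set p : 'rV[R]_n | enorm p <= r].
Proof.
apply: bounded_closed_compact; last exact: closed_enorm_le.
exists r; split; first exact: num_real.
by move=> M rM p /= pr; rewrite (le_trans (mx_norm_le_enorm p))// (le_trans pr)// ltW.
Qed.

Lemma compact_unit_circle : compact unit_circle.
Proof.
apply: (subclosed_compact _ (@compact_enorm_le 2 1)); last by move=> p /= ->.
have -> : unit_circle = [set p | enorm p <= 1] `&` ~` (@open_disk R).
  apply/seteqP; split => [p /= p1|p /= [p1 np]].
    by split; [rewrite p1|move=> /open_diskE; rewrite p1 ltxx].
  by apply/eqP; rewrite eq_le p1 /= leNgt; apply/negP => /open_diskE.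
apply: closedI; first exact: closed_enorm_le.
by apply: open_closedC; exact: open_interior.
Qed.

Lemma open_disk_sub (p : 'rV[R]_2) : open_disk p -> disk p.
Proof. by move=> /open_diskE /ltW. Qed.

Lemma open_disk_val (x : X) : open_disk (set_val x).
Proof. by have := valP x; rewrite inE. Qed.

Lemma set_val_continuous : continuous (set_val : X -> 'rV[R]_2).
Proof. exact: (@initial_continuous _ _ (set_val : X -> 'rV[R]_2)). Qed.

Lemma nbhs_hyperbolic (x : X) (B : set X) : nbhs x B ->
  exists2 V, nbhs (set_val x : 'rV[R]_2) V & set_val @^-1` V `<=` B.
Proof.
rewrite nbhsE => -[U [[V oV <-] Vx] UB]; exists V => //.
by apply: open_nbhs_nbhs; split.
Qed.

(** A cluster point found in the plane has norm at most r < 1, so it belongs to the hyperbolic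
    plane. *)
Lemma compact_hyperbolic_ball (r : R) : r < 1 ->
  compact [set x : X | enorm (set_val x) <= r].
Proof.
move=> r1 Fl PF FB.
have [z [zr zc]] := @compact_enorm_le 2 r (fmap (set_val : X -> 'rV[R]_2) Fl) _ FB.
have oz : open_disk z by apply/open_diskE; exact: le_lt_trans zr r1.
exists (exist _ z (mem_set oz) : X); split => // A B FA /nbhs_hyperbolic[V zV VB].
have FA' : Fl ((set_val : X -> 'rV[R]_2) @^-1` ((set_val : X -> 'rV[R]_2) @` A)).
  by apply: filterS FA => x Ax; exists x.
have [_ [[x Ax <-] Vx]] := zc _ V FA' zV.
by exists x; split => //; exact: VB.
Qed.

Lemma closed_hyperbolic_ball (r : R) : closed [set x : X | enorm (set_val x) <= r].
Proof.
apply: (@closed_comp _ _ (set_val : X -> 'rV[R]_2) [set p | enorm p <= r]).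
  by move=> x _; exact: set_val_continuous.
exact: closed_enorm_le.
Qed.

Lemma hyperbolic_infinityP (p : nat -> X) :
  (Some (p k) : one_point_compactification X) @[k --> \oo]
       --> (None : one_point_compactification X) ->
  forall r, r < 1 -> \forall k \near \oo, r < enorm (set_val (p k)).
Proof.
move=> pN r r1; pose K := [set x : X | enorm (set_val x) <= r].
have : nbhs (None : one_point_compactification X) ((Some @` (~` K)) `|` [set None]).
  by exists K => //; split; [exact: compact_hyperbolic_ball|exact: closed_hyperbolic_ball].
move=> /pN [n _ hn]; exists n => // k nk; have [[x Kx [xp]]|//] := hn k nk.
by rewrite -xp ltNge; apply/negP.
Qed.

(** A compact subset of the hyperbolic plane is compact, hence closed, in the plane and misses the
    circle; the sequence therefore leaves it. *)
Lemma hyperbolic_infinity_of_circle (p : nat -> X) z : unit_circle z ->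
  (set_val (p k) : 'rV[R]_2) @[k --> \oo] --> z ->
  (Some (p k) : one_point_compactification X) @[k --> \oo]
       --> (None : one_point_compactification X).
Proof.
move=> z1 pz U [K [cK _] KU].
have cK' : closed ((set_val : X -> 'rV[R]_2) @` K).
  apply: compact_closed; first exact: norm_hausdorff.
  apply: continuous_compact => //.
  by apply: continuous_subspaceT; exact: set_val_continuous.
have : nbhs z (~` ((set_val : X -> 'rV[R]_2) @` K)).
  apply: open_nbhs_nbhs; split; first exact: closed_openC.
  by move=> [x _ xz]; have /open_diskE := open_disk_val x; rewrite xz z1 ltxx.
move=> /pz [n _ hn]; exists n => // k nk; apply: KU; left; exists (p k) => //.
by move=> Kp; apply: (hn k nk); exists (p k).
Qed.

Definition circle_point (t : R) : 'rV[R]_2 :=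
  \row_i (if i == 0 then cos (pi *+ 2 * t) else sin (pi *+ 2 * t)).

Lemma enorm_circle_point t : enorm (circle_point t) = 1.
Proof. by rewrite /enorm edot2 !mxE /= -!expr2 cos2Dsin2 sqrtr1. Qed.

Lemma mvt_lipschitz1 (g dg : R -> R) : (forall x : R, is_derive x 1 g (dg x)) ->
  (forall x : R, `|dg x| <= 1) -> forall x y : R, `|g x - g y| <= `|x - y|.
Proof.
move=> hg hdg x y; wlog xy : x y / y <= x => [h|].
  by have [/h//|/ltW /h] := leP y x; rewrite distrC (distrC y).
have [|c _ ->] := MVT_segment xy (fun z _ => hg z).
  by apply: derivable_within_continuous => z _; have [] := hg z.
by rewrite normrM ler_piMl.
Qed.

Lemma circle_point_lipschitz s t :
  enorm (circle_point s - circle_point t) <= 16 * `|s - t|.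
Proof.
apply: (le_trans (enorm_le_sum _)); rewrite !big_ord_recl big_ord0 addr0 !mxE /=.
have hs (x y : R) : `|sin x - sin y| <= `|x - y|.
  by apply: (@mvt_lipschitz1 sin cos) => z; rewrite ler_norml cos_geN1 cos_le1.
have hc (x y : R) : `|cos x - cos y| <= `|x - y|.
  apply: (@mvt_lipschitz1 cos (fun z => - sin z)) => z.
  by rewrite normrN ler_norml sin_geN1 sin_le1.
(* 2 pi <= 8, from pi / 2 < 2. *)
have h : `|pi *+ 2 * s - pi *+ 2 * t| <= 8 * `|s - t|.
  rewrite -mulrBr normrM ler_wpM2r//.
  have := @pihalf_lt2 R; have := @pi_ge0 R; rewrite ltr_pdivrMr// mulr2n => ? ?.
  by rewrite ger0_norm; lra.
by rewrite (le_trans (lerD (le_trans (hc _ _) h) (le_trans (hs _ _) h)))//; lra.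
Qed.

Lemma circle_point_onto p : unit_circle p -> exists2 t, t \in `[0, 1] & circle_point t = p.
Proof.
move=> p1; have : p 0 0 ^+ 2 + p 0 1 ^+ 2 = 1.
  by rewrite !expr2 -edot2 -sqr_enorm p1 expr1n.
set a := p 0 0; set b := p 0 1 => ab.
have a1 : -1 <= a <= 1.
  by rewrite -ler_norml (le_trans (enorm_coord p 0))// p1.
pose th := acos a.
have th0 : 0 <= th by exact: acos_ge0.
have thpi : th <= pi by exact: acos_lepi.
have cth : cos th = a by apply: acosK; rewrite in_itv.
have sth : sin th = `|b|.
  by rewrite sin_acos// -sqrtr_sqr -ab addrAC subrr add0r.
have pi0 := @pi_gt0 R.
have p2 : 0 < pi *+ 2 :> R by rewrite mulrn_wgt0.
have pp : pi *+ 2 != 0 :> R by rewrite gt_eqF.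
have th1 : th / (pi *+ 2) <= 1 by rewrite ler_pdivrMr// mulr2n; lra.
have th2 : 0 <= th / (pi *+ 2) by rewrite divr_ge0// ltW.
have pE (x : 'rV[R]_2) : x 0 0 = a -> x 0 1 = b -> x = p.
  move=> x0 x1; apply/rowP => i; have [->|i0] := eqVneq i 0; first by rewrite x0.
  have -> : i = 1 by apply/val_inj; case: i i0 => -[|[|]].
  by rewrite x1.
have [b0|b0] := leP 0 b.
  exists (th / (pi *+ 2)).
    by rewrite in_itv /= th2.
  by apply: pE; rewrite !mxE /= mulrC divfK// ?cth// sth ger0_norm.
(* Lower half circle: the angle is 2 pi - acos a. *)
exists (1 - th / (pi *+ 2)).
  by rewrite in_itv /= subr_ge0 gerBl th1.
have aE : pi *+ 2 * (1 - th / (pi *+ 2)) = - th + pi *+ 2.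
  by rewrite mulrBr mulr1 mulrC divfK// addrC.
apply: pE; rewrite !mxE /= aE ?cosD2pi ?sinD2pi ?cosN ?sinN//.
by rewrite sth ltr0_norm// opprK.
Qed.

End DiskTopology.

(** * Embedding of the interior and limit set, from injectivity on the closed disk *)

Section Embedding.
Context {R : realType}.
Local Notation disk := (@closed_disk R).
Local Notation X := (hyperbolic_plane R).
Variable f : 'rV[R]_2 -> 'rV[R]_3.
Hypothesis f_inj : forall p q, disk p -> disk q -> f p = f q -> p = q.
Hypothesis f_uc : forall eps, 0 < eps -> exists2 d, 0 < d &
  forall p q, disk p -> disk q -> enorm (q - p) <= d -> enorm (f q - f p) <= eps.

Lemma within_disk_continuous : {within disk, continuous f}.
Proof.
apply/subspace_continuousP => p dp A /nbhs_enorm[c c0 hc].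
have [d d0 hd] := f_uc c0.
apply/(@nbhs_enorm _ _ p (fun q => disk q -> A (f q))); exists d => // q qp dq.
exact/hc/hd.
Qed.

Lemma closed_image (K : set 'rV[R]_2) : K `<=` disk -> compact K -> closed (f @` K).
Proof.
move=> Kd cK; apply: compact_closed; first exact: norm_hausdorff.
by apply: continuous_compact => //; exact: continuous_subspaceW within_disk_continuous.
Qed.

Lemma interior_embedding : topological_embedding (restrict_interior f).
Proof.
split.
- move=> x y /f_inj fxy; apply: val_inj; apply: fxy;
    exact/open_disk_sub/open_disk_val.
- move=> x; apply: continuous_comp; first exact: set_val_continuous.
  have := open_disk_val x; move: (set_val x) => p op A /nbhs_enorm[c c0 hc].
  have [d d0 hd] := f_uc c0; have /open_diskE p1 := op.
  apply/(@nbhs_enorm _ _ p (f @^-1` A)); exists (Num.min d (1 - enorm p)).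
    by rewrite lt_min d0 subr_gt0.
  move=> q; rewrite le_min => /andP[qd q1]; apply/hc/hd => //; first exact: open_disk_sub.
  by rewrite /closed_disk /=; have := enormD (q - p) p; rewrite subrK; lra.
- move=> U [V oV VU].
  (* K contains the boundary circle, so it is compact; its closed image misses f(U) by injectivity
     on the whole disk. *)
  pose K := disk `&` ~` (V `&` (@open_disk R)).
  have cK : compact K.
    apply: (subclosed_compact _ (@compact_enorm_le R 2 1)); last by move=> p [].
    apply: closedI; first exact: closed_enorm_le.
    by apply: open_closedC; apply: openI => //; exact: open_interior.
  have fK : closed (f @` K) by apply: closed_image => // p [].
  exists (~` (f @` K)); first exact: closed_openC.
  rewrite -VU; apply/seteqP; split => x /=.
    move=> Vx [y [dy nVy] yx].
    have xy := f_inj dy (open_disk_sub (open_disk_val x)) yx.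
    by apply: nVy; rewrite xy; split => //; exact: open_disk_val.
  move=> nfK; apply: contrapT => nVx; apply: nfK; exists (set_val x) => //.
  by split; [exact/open_disk_sub/open_disk_val|case].
Qed.

Lemma limit_set_circle : limit_set (restrict_interior f) = f @` unit_circle.
Proof.
have cC : closed (f @` unit_circle).
  by apply: closed_image; [move=> p /= h; rewrite /closed_disk /= h|exact: compact_unit_circle].
apply/seteqP; split => y.
  move=> [p [pN fp]]; apply: contrapT => ny.
  have /nbhs_enorm[c c0 hc] : nbhs y (~` (f @` unit_circle)).
    by apply: open_nbhs_nbhs; split => //; exact: closed_openC.
  have c2 : 0 < c / 2 by rewrite divr_gt0.
  have [d d0 hd] := f_uc c2.
  (* The bound 1 - d puts z within d of its radial projection w on the circle; 1/2 keeps z away from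
     0. *)
  have m1 : Num.max (1 - d) (1 / 2) < 1 by rewrite gt_max; apply/andP; split; lra.
  have [n1 _ hn1] := hyperbolic_infinityP pN m1.
  have [n2 _ hn2] := (cvg_enormP _ _ _).1 fp _ c2.
  pose k := (n1 + n2)%N; have := hn1 k (leq_addr _ _); have := hn2 k (leq_addl _ _).
  rewrite /= /restrict_interior; have := open_disk_val (p k).
  move: (set_val (p k)) => z /open_diskE z1 fz; rewrite gt_max => /andP[zd z2].
  have z0 : 0 < enorm z by lra.
  pose w := (enorm z)^-1 *: z.
  have w1 : enorm w = 1 by rewrite enormZ gtr0_norm ?invr_gt0// mulVf// gt_eqF.
  apply: (hc (f w)); last by exists w.
  have wz : enorm (w - z) <= d.
    have -> : w - z = ((enorm z)^-1 - 1) *: z by rewrite scalerBl scale1r.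
    rewrite enormZ ger0_norm ?subr_ge0 ?invf_ge1 ?ltW// mulrBl mul1r mulVf ?gt_eqF//.
    by lra.
  have := hd z w (ltW z1) _ wz; rewrite /closed_disk /= w1 => /(_ (lexx _)) fw.
  have -> : f w - y = (f w - f z) + (f z - y) by rewrite addrA subrK.
  by rewrite (le_trans (enormD _ _))//; lra.
move=> [z z1 <-].
pose t (k : nat) : R := 1 - k.+2%:R^-1.
have t01 k : 0 <= t k < 1.
  rewrite /t subr_ge0 invf_le1 ?ltr0n// ler1n /= ltrBlDr ltrDl invr_gt0.
  by rewrite ltr0n.
have ot k : open_disk (t k *: z).
  have /andP[t0 t1] := t01 k.
  by apply/open_diskE; rewrite enormZ z1 mulr1 ger0_norm.
have tz : (t k *: z) @[k --> \oo] --> z.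
  apply/cvg_enormP => eps eps0.
  exists (Num.bound eps^-1) => // k /= nk.
  have -> : t k *: z - z = - (k.+2%:R^-1 *: z).
    by rewrite /t scalerBl scale1r addrAC subrr add0r.
  rewrite enormN enormZ z1 mulr1 gtr0_norm ?invr_gt0 ?ltr0n// invf_ple ?posrE ?ltr0n//.
  have := archi_boundP (ltW (_ : 0 < eps^-1)); rewrite invr_gt0 => /(_ eps0) /ltW /le_trans; apply.
  by rewrite ler_nat (leq_trans nk)// -addn2 leq_addr.
pose P (k : nat) : X := exist _ (t k *: z) (mem_set (ot k)).
exists P; split; first exact: (@hyperbolic_infinity_of_circle R P z z1 tz).
apply/cvg_enormP => eps eps0; have [d d0 hd] := f_uc eps0.
have [n _ hn] := (cvg_enormP _ _ _).1 tz _ d0.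
exists n => // k /hn; apply: hd; last exact/open_disk_sub/ot.
by rewrite /closed_disk /= z1.
Qed.

Lemma circle_closed_curve : closed_curve (f @` unit_circle).
Proof.
exists (f \o circle_point); split.
- apply: continuous_subspaceT => t A /nbhs_enorm[c c0 hc].
  have [d d0 hd] := f_uc c0.
  apply/nbhs_normP; exists (d / 16); first by rewrite /= divr_gt0.
  move=> s /= ts; apply/hc/hd; rewrite ?/closed_disk /= ?enorm_circle_point//.
  apply: (le_trans (circle_point_lipschitz _ _)).
  by rewrite mulrC -ler_pdivlMr// distrC ltW.
- rewrite /= /circle_point mulr0 mulr1.
  by congr f; apply/rowP => i; rewrite !mxE cos0 sin0 cos2pi sin2pi.
- apply/seteqP; split => y /= [z].
    by move=> _ <-; exists (circle_point z) => //; exact: enorm_circle_point.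
  by move=> /circle_point_onto[t t01 <-] <-; exists t.
Qed.

End Embedding.

(** * Hausdorff dimension *)

Section Hausdorff.
Context {R : realType} {n : nat}.
Implicit Types (U A : set 'rV[R]_n) (s d : R).

Lemma ediam_le U d : (forall p q, U p -> U q -> edist p q <= d) -> (ediam U <= d%:E)%E.
Proof.
by move=> h; apply: ge_ereal_sup => _ [p Up [q Uq <-]]; rewrite lee_fin h.
Qed.

Lemma edist_le_ediam U p q : U p -> U q -> ((edist p q)%:E <= ediam U)%E.
Proof. by move=> Up Uq; apply: ereal_sup_ubound; exists p => //; exists q. Qed.

Lemma ediam_fin U d p : U p -> (ediam U <= d%:E)%E ->
  exists r, [/\ 0 <= r, r <= d & ediam U = r%:E].
Proof.
move=> Up Ud; have := edist_le_ediam Up Up; rewrite /edist subrr enorm0.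
move: Ud; case: (ediam U) => [r| |]//; rewrite !lee_fin => rd r0.
by exists r.
Qed.

Lemma hausdorff_gauge_ge0 s U : (0 <= hausdorff_gauge s U)%E.
Proof. by rewrite /hausdorff_gauge; case: ifP => // _; exact: poweR_ge0. Qed.

Lemma hausdorff_gauge_le s U d : 0 <= s -> (ediam U <= d%:E)%E -> 0 <= d ->
  (hausdorff_gauge s U <= (d `^ s)%:E)%E.
Proof.
move=> s0 Ud d0; rewrite /hausdorff_gauge; case: ifP => [_|/negbT/set0P[p Up]].
  by rewrite lee_fin powR_ge0.
have [r [r0 rd ->]] := ediam_fin Up Ud.
by rewrite poweR_EFin lee_fin ge0_ler_powR// nnegrE.
Qed.

Lemma hausdorff_content_ge0 s d A : (0 <= hausdorff_content s d A)%E.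
Proof.
apply/ereal_infP => _ [U _ <-]; apply: nneseries_ge0 => k _ _.
exact: hausdorff_gauge_ge0.
Qed.

Lemma hausdorff_content_finite_cover s d x N (U : nat -> set 'rV[R]_n) A :
  0 <= s -> 0 <= x -> x <= d -> A `<=` \bigcup_(k < N) U k ->
  (forall k, (ediam (U k) <= x%:E)%E) ->
  (hausdorff_content s d A <= (N%:R * x `^ s)%:E)%E.
Proof.
(* Padding with empty sets is free, their gauge being 0 even for s = 0. *)
move=> s0 x0 xd AU dU; pose V k := if (k < N)%N then U k else set0.
have dV k : (ediam (V k) <= x%:E)%E.
  by rewrite /V; case: ifP => // _; apply: ediam_le.
have gV k : (hausdorff_gauge s (V k) <= (if (k < N)%N then x `^ s else 0)%:E)%E.
  have := hausdorff_gauge_le s0 (dV k) x0.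
  by rewrite /V; case: ifP => // _ _; rewrite /hausdorff_gauge eqxx.
apply: (@le_trans _ _ (\sum_(0 <= k <oo) hausdorff_gauge s (V k))%E).
  apply: ereal_inf_lbound; exists V => //; split.
    by move=> p /AU[k /= kN Ukp]; exists k => //; rewrite /V kN.
  by move=> k; apply: (le_trans (dV k)); rewrite lee_fin.
apply: lime_le; first by apply: is_cvg_nneseries => k _ _; exact: hausdorff_gauge_ge0.
apply: nearW => m.
apply: (@le_trans _ _ (\sum_(0 <= k < m) (if (k < N)%N then x `^ s else 0)%:E)%E).
  by apply: lee_sum => k _; exact: gV.
rewrite sumEFin lee_fin.
have : \sum_(0 <= k < m) (if (k < N)%N then x `^ s else 0) = (minn m N)%:R * x `^ s.
  elim: m => [|m IH]; first by rewrite big_nil min0n mul0r.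
  rewrite big_nat_recr//= IH; case: ltnP => mN.
    by rewrite (minn_idPl mN) -addn1 natrD mulrDl mul1r.
  by rewrite (minn_idPr (leqW mN)) addr0.
by move=> ->; rewrite ler_wpM2r ?powR_ge0// ler_nat geq_minr.
Qed.

(* The distance to g 0 is 1-Lipschitz and maps the curve onto a nondegenerate
   interval, whose Lebesgue measure is positive. *)
Lemma hausdorff_measure_curve_neq0 (g : R -> 'rV[R]_n) (b s : R) : 0 <= s <= 1 -> 0 <= b ->
  {within `[0, b], continuous (fun t => enorm (g t - g 0))} -> g b <> g 0 ->
  forall A, (forall t, t \in `[0, b] -> A (g t)) -> hausdorff_measure s A <> 0%E.
Proof.
move=> /andP[s0 s1] b0 gc gb A gA mA0.
pose phi (p : 'rV[R]_n) := enorm (p - g 0).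
have phi_lip p q : `|phi p - phi q| <= edist p q.
  rewrite /edist ler_norml; apply/andP; split.
    have := enormD (q - p) (p - g 0); rewrite addrA subrK enormBC /phi; lra.
  by have := enormD (p - q) (q - g 0); rewrite addrA subrK /phi; lra.
pose l := phi (g b).
have l0 : 0 < l.
  rewrite lt_def enorm_ge0 andbT; apply/negP => /eqP /enorm_eq0 /eqP.
  by rewrite subr_eq0 => /eqP.
have phi0 : phi (g 0) = 0 by rewrite /phi subrr enorm0.
have onto v : 0 <= v <= l -> exists2 p, A p & phi p = v.
  move=> v0l; have [|c cb <-] := @IVT R _ 0 b v b0 gc.
    by rewrite -/(phi (g 0)) -/(phi (g b)) phi0 min_l ?max_r// ltW.
  by exists (g c) => //; exact: gA.
have content0 : hausdorff_content s 1 A = 0%E.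
  apply/eqP; rewrite eq_le hausdorff_content_ge0 andbT -mA0.
  by apply: ereal_sup_ubound; exists 1 => //=.
(* The intervals below have length at most twice the gauge, hence total length below l / 2, too
   little to cover [0, l]. *)
have l4 : (hausdorff_content s 1 A < (l / 4)%:E)%E.
  by rewrite content0 lte_fin divr_gt0.
have [_ [U [AU dU] <-] Ul] := ereal_inf_lt l4.
pose c k : R := if pselect (exists p, U k p) is left h then phi (sval (cid h)) else 0.
pose r k : R := fine (hausdorff_gauge s (U k)).
have hI k p : U k p -> hausdorff_gauge s (U k) = (r k)%:E /\ c k - r k <= phi p <= c k + r k.
  move=> Up; have [x [x0 x1 xE]] := ediam_fin Up (dU k).
  have gE : hausdorff_gauge s (U k) = (x `^ s)%:E.
    rewrite /hausdorff_gauge xE poweR_EFin; case: ifP => // /eqP Uk0.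
    by rewrite Uk0 in Up.
  rewrite /r gE /=; split => //.
  (* Diameters at most 1 and s <= 1: the gauge dominates the diameter, and can serve as the radius
     of an interval containing phi(U k). *)
  have xs : x <= x `^ s.
    have [->|xn0] := eqVneq x 0; first exact: powR_ge0.
    by apply: ger1_powR => //; rewrite lt_def xn0 x0.
  rewrite /c; case: pselect => [h|]; last by case; exists p.
  case: cid => q /= Uq.
  have := edist_le_ediam Up Uq; rewrite xE lee_fin => pq.
  by have := le_trans (phi_lip p q) pq; rewrite ler_norml => /andP[? ?]; apply/andP; split; lra.
have r0 k : 0 <= r k by rewrite fine_ge0// hausdorff_gauge_ge0.
pose I k : set R := `[(c k - r k), (c k + r k)]%classic.
pose J k : set R := if pselect (exists p, U k p) is left _ then I k else set0.
have cover : `[0, l]%classic `<=` \bigcup_k J k.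
  move=> v /=; rewrite in_itv /= => /onto[p Ap <-].
  have [k _ Ukp] := AU p Ap; exists k => //; rewrite /J.
  case: pselect => [_|]; last by case; exists p.
  by rewrite /I /= in_itv /=; have [_] := hI k p Ukp.
have mJ k : measurable (J k) by rewrite /J; case: pselect => _; [exact: measurable_itv|].
pose I0 : set R := `[0, l]%classic.
have : (@lebesgue_measure R I0 <=
    \sum_(0 <= k <oo) lebesgue_measure (J k))%E.
  by apply: measure_sigma_subadditive => //; exact: measurable_itv.
rewrite /I0 lebesgue_measure_itv /= lte_fin l0 sube0.
apply/negP; rewrite -ltNge.
apply: (@le_lt_trans _ _ (\sum_(0 <= k <oo) (2%:E * hausdorff_gauge s (U k)))%E).
  apply: lee_nneseries => [k _ _|k _]; first exact: measure_ge0.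
  rewrite /J; case: pselect => [[p Up]|_]; last first.
    by rewrite measure0 mule_ge0// hausdorff_gauge_ge0.
  rewrite lebesgue_measure_itv /=; have [-> _] := hI k p Up.
  case: ifP => _; last by rewrite mule_ge0// lee_fin.
  by rewrite -EFinB -EFinM lee_fin; lra.
rewrite nneseriesZl; last by move=> k _; exact: hausdorff_gauge_ge0.
have S0 : (0 <= \sum_(0 <= k <oo) hausdorff_gauge s (U k))%E.
  by apply: nneseries_ge0 => k _ _; exact: hausdorff_gauge_ge0.
move: Ul S0; case: (\sum_(0 <= k <oo) _)%E => [x| |]//.
by rewrite lte_fin lee_fin -EFinM lte_fin => ? ?; lra.
Qed.

End Hausdorff.

(** * Dimension of the image of the circle *)

Section CurveDimension.
Context {R : realType}.
Variable f : 'rV[R]_2 -> 'rV[R]_3.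
Local Notation disk := (@closed_disk R).
Hypothesis f_holder : forall b : R, 0 < b < 1 -> holder_on disk b f.
Hypothesis f_inj : forall p q, disk p -> disk q -> f p = f q -> p = q.
Hypothesis f_uc : forall eps, 0 < eps -> exists2 d, 0 < d &
  forall p q, disk p -> disk q -> enorm (q - p) <= d -> enorm (f q - f p) <= eps.

Lemma hausdorff_measure_circle_image s : 1 < s ->
  hausdorff_measure s (f @` @unit_circle R) = 0%E.
Proof.
move=> s1; have s0 : 0 < s by lra.
(* Both b < 1 and b s > 1 hold; the surplus [gam] is (s - 1) / (s + 1). *)
pose b := 2 / (1 + s).
have s10 : 0 < 1 + s by lra.
have b01 : 0 < b < 1.
  by rewrite divr_gt0//= ltr_pdivrMr// mul1r; lra.
have [C hC] := f_holder b01.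
have /andP[b0 b1] := b01.
pose C' := `|C| + 1.
have C0 : 0 < C' by rewrite ltr_wpDl.
pose gam := b * s - 1.
have gam0 : 0 < gam.
  by rewrite subr_gt0 /b mulrAC ltr_pdivlMr// mul1r; lra.
have small d : 0 < d -> forall eps, 0 < eps ->
    (hausdorff_content s d (f @` @unit_circle R) <= eps%:E)%E.
  move=> d0 eps eps0.
  pose K := 16 * C' `^ s.
  have K0 : 0 < K by rewrite mulr_gt0// powR_gt0.
  (* The circle is cut into N arcs of diameter at most x = 16 / N. Their images have total gauge at
     most N (C' x^b)^s = K x^gam, and y makes this at most eps and each diameter at most d. *)
  pose y := Num.min ((eps / K) `^ gam^-1) ((d / C') `^ b^-1).
  have y0 : 0 < y by rewrite lt_min !powR_gt0// divr_gt0.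
  pose N := (Num.bound (16 / y)).+1.
  have N0 : 0 < N%:R :> R by rewrite ltr0n.
  pose x := 16 / N%:R : R.
  have x0 : 0 < x by rewrite divr_gt0.
  have xy : x <= y.
    rewrite ler_pdivrMr// mulrC -ler_pdivrMr// ltW//.
    have h16 : 0 <= 16 / y by rewrite divr_ge0// ltW.
    by apply: (lt_le_trans (archi_boundP h16)); rewrite ler_nat leqnSn.
  have pow_le (z w : R) : 0 < z -> 0 < w -> x <= z `^ w^-1 -> x `^ w <= z.
    move=> z0 w0 xz; rewrite -[leRHS]powRr1 ?(ltW z0)// -(mulVf (lt0r_neq0 w0)) powRrM.
    by apply: ge0_ler_powR; rewrite ?nnegrE ?powR_ge0//; exact: ltW.
  have xg : x `^ gam <= eps / K.
    by apply: pow_le; rewrite ?divr_gt0// (le_trans xy)// ge_min lexx.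
  have xb : x `^ b <= d / C'.
    by apply: pow_le; rewrite ?divr_gt0// (le_trans xy)// ge_min lexx orbT.
  pose U k := f @` (@circle_point R @` `[k%:R / N%:R, k.+1%:R / N%:R]%classic).
  have cd t : disk (circle_point t) by rewrite /closed_disk /= enorm_circle_point.
  have dU k : (ediam (U k) <= (C' * x `^ b)%:E)%E.
    apply: ediam_le => _ _ [_ [t ht <-] <-] [_ [t' ht' <-] <-].
    apply: (le_trans (hC _ _ (cd t) (cd t'))).
    apply: (@le_trans _ _ (C' * edist (circle_point t) (circle_point t') `^ b)).
      by rewrite ler_wpM2r ?powR_ge0// /C'; have := ler_norm C; lra.
    rewrite ler_pM2l//; apply: ge0_ler_powR; rewrite ?nnegrE ?enorm_ge0 ?(ltW b0) ?(ltW x0)//.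
    rewrite /edist (le_trans (circle_point_lipschitz _ _))// ler_pM2l//.
    move: ht ht'; rewrite /= !in_itv /= -addn1 natrD mulrDl mul1r => /andP[? ?] /andP[? ?].
    by rewrite ler_norml; apply/andP; split; lra.
  have cover : f @` @unit_circle R `<=` \bigcup_(k < N) U k.
    move=> _ [p p1 <-]; have [t t01 <-] := circle_point_onto p1.
    move: t01; rewrite in_itv /= => /andP[t0 t1].
    (* At t = 1 the integer part of t N is N, one past the last arc. *)
    have [t_lt|t_ge] := ltP t 1; last first.
      exists N.-1 => //=; exists (circle_point t) => //; exists t => //=.
      have -> : t = 1 by apply/eqP; rewrite eq_le t1.
      by rewrite in_itv /= divff ?gt_eqF// lexx andbT ler_pdivrMr// mul1r ler_nat.
    exists (Num.truncn (t * N%:R)) => /=.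
      have tN : 0 <= t * N%:R by rewrite mulr_ge0// ltW.
      rewrite -(@ltr_nat R) (le_lt_trans _ (_ : t * N%:R < _))//.
        by have /andP[] := truncn_itv tN.
      by rewrite gtr_pMl.
    exists (circle_point t) => //; exists t => //=.
    have tN : 0 <= t * N%:R by rewrite mulr_ge0// ltW.
    have /andP[h1 h2] := truncn_itv tN.
    by rewrite in_itv /= ler_pdivrMr// h1 /= ler_pdivlMr// ltW.
  have Cxd : C' * x `^ b <= d by rewrite mulrC -ler_pdivlMr.
  have Cx0 : 0 <= C' * x `^ b by rewrite mulr_ge0 ?powR_ge0 ?(ltW C0).
  apply: (le_trans (hausdorff_content_finite_cover (ltW s0) Cx0 Cxd cover dU)).
  rewrite lee_fin powRM ?powR_ge0 ?(ltW C0)// -powRrM.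
  have -> : x `^ (b * s) = x `^ gam * x.
    rewrite -{3}(powRr1 (ltW x0)) -powRD; last by rewrite (gt_eqF x0) implybT.
    by rewrite /gam subrK.
  have -> : N%:R * (C' `^ s * (x `^ gam * x)) = K * x `^ gam.
    by rewrite /K /x; field; rewrite gt_eqF.
  by rewrite mulrC -ler_pdivlMr.
apply/eqP; rewrite eq_le; apply/andP; split.
  apply: ge_ereal_sup => _ [d d0 <-]; apply/lee_addgt0Pr => eps eps0; rewrite add0e.
  exact: small.
apply: le_trans (hausdorff_content_ge0 s 1 (f @` @unit_circle R)) _.
by apply: ereal_sup_ubound; exists 1 => //=.
Qed.

Lemma hausdorff_dim_circle_image : hausdorff_dim (f @` @unit_circle R) = 1%:E.
Proof.
have cd t : disk (circle_point t) by rewrite /closed_disk /= enorm_circle_point.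
apply/eqP; rewrite eq_le; apply/andP; split.
  apply/lee_addgt0Pr => eps eps0; apply: ereal_inf_lbound.
  exists (1 + eps); last by rewrite EFinD.
  by split; [lra|apply: hausdorff_measure_circle_image; lra].
apply/ereal_infP => _ [s [s0 ms] <-]; rewrite lee_fin leNgt; apply/negP => s1.
(* Half of the circle is used: its ends are antipodal, so their images differ, whereas the full
   parametrization closes up. *)
apply: (@hausdorff_measure_curve_neq0 R 3 (f \o circle_point) 2^-1 s _ _ _ _
   (f @` @unit_circle R)) ms => //.
- by rewrite s0 ltW.
- apply: continuous_subspaceT => t A /(nbhs_normP (enorm (f (circle_point t) - f (circle_point 0)))).
  move=> [c /= c0 hc]; have c2 : 0 < c / 2 by rewrite divr_gt0.
  have [d d0 hd] := f_uc c2.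
  apply/nbhs_normP; exists (d / 16); first by rewrite /= divr_gt0.
  move=> u /= tu; apply: hc => /=.
  apply: (@le_lt_trans _ _ (c / 2)); last by rewrite ltr_pdivrMr// ltr_pMr// ltr1n.
  have : enorm (f (circle_point u) - f (circle_point t)) <= c / 2.
    apply: hd => //; rewrite (le_trans (circle_point_lipschitz _ _))//.
    by rewrite mulrC -ler_pdivlMr// distrC ltW.
  set a := f (circle_point u); set a' := f (circle_point t); set o := f (circle_point 0) => aa.
  have := enormD (a - a') (a' - o); have := enormD (a' - a) (a - o).
  by rewrite !addrA !subrK (enormBC a' a) ler_norml => ? ?; apply/andP; split; lra.
- move=> /f_inj => /(_ (cd _) (cd _)) /rowP /(_ 0); rewrite !mxE /= mulr0 cos0.
  have -> : pi *+ 2 * 2^-1 = pi :> R by rewrite -[pi *+ 2]mulr_natr mulfK.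
  by rewrite cospi => h; lra.
- by move=> t _; exists (circle_point t) => //; exact: enorm_circle_point.
Qed.

End CurveDimension.

Theorem theorem1 (R : realType) :
  exists f : 'rV[R]_2 -> 'rV[R]_3,
    [/\ forall b : R, 0 < b < 1 -> holder_on (@closed_disk R) b f,
        C1_isometric_embedding f,
        closed_curve (limit_set (restrict_interior f)) &
        hausdorff_dim (limit_set (restrict_interior f)) = 1%:E].
Proof.
have [F [e hF]] := @approximations R.
have [f hf] := limit_map hF.
have [T hT] := limit_tangent hF.
have holder b : 0 < b < 1 -> holder_on (@closed_disk R) b f by exact: limit_holder.
have uc := limit_uniformly_continuous hF hf.
have inj := limit_injective hF hf.
exists f; split => //.
- split.
  + exact: (limit_C1 hF hf hT).
  + exact: (limit_immersion hF hf hT).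
  + exact: (interior_embedding inj uc).
  + exact: (limit_isometric hF hf hT).
- by rewrite (limit_set_circle uc); exact: circle_closed_curve.
- by rewrite (limit_set_circle uc); exact: hausdorff_dim_circle_image.
Qed.
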